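(* Let $n\ge3$, $\alpha\ge0$, $1\le p\le\infty$, and let $w_0$ be the solution in $\mathbb{R}^n_+$ of the first boundary value problem for the biharmonic equation $$\Delta^2w_0=0\ \text{in}\ \mathbb{R}^n_+,\qquad w_0\big|_{x_n=0}=0,\qquad\frac{\partial w_0}{\partial x_n}\Big|_{x_n=0}=f_1\in L^p(\mathbb{R}^{n-1}),$$ given by $w_0(x)=\frac{2}{\omega_n}\int_{\mathbb{R}^{n-1}}\frac{x_n^2}{|y-x|^n}f_1(y')\,dy'$, $y=(y',0)$. Then for every $x\in\mathbb{R}^n_+$ $$\left|\nabla\big(x_n^{n\alpha-2}w_0(x)\big)\right|\le C_{\alpha,n,p}\,x_n^{\,n\alpha-2-(n-1)/p}\left\|\frac{\partial w_0}{\partial x_n}\right\|_p,$$ where the sharp constant $C_{\alpha,n,p}$ is the same as the sharp constant in the inequality $$\left|\nabla\big(x_n^{n\alpha-1}v(x)\big)\right|\le C_{\alpha,n,p}\,x_n^{\,n\alpha-2-(n-1)/p}\,\|v\|_p,\qquad v\in h^p(\mathbb{R}^n_+).$$ For instance, the following inequalities hold with sharp coefficients: $$\left|\nabla\left\{\frac{w_0(x)}{x_n^2}\right\}\right|\le\frac{1}{x_n^2}\left\|\frac{\partial w_0}{\partial x_n}\right\|_\infty\quad(\alpha=0,\ p=\infty),$$ $$\left|\nabla\big(x_n^{n-2}w_0(x)\big)\right|\le(n-1)\,x_n^{n-2}\left\|\frac{\partial w_0}{\partial x_n}\right\|_\infty\quad(\alpha=1,\ p=\infty).$$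
   Context: $\mathbb{R}^n_+=\{x=(x',x_n):x'\in\mathbb{R}^{n-1},\ x_n>0\}$; $\omega_n=2\pi^{n/2}/\Gamma(n/2)$. $\left\|\partial w_0/\partial x_n\right\|_p$ denotes the $L^p(\mathbb{R}^{n-1})$-norm of the boundary values $f_1$ of $\partial w_0/\partial x_n$ on $x_n=0$. $h^p(\mathbb{R}^n_+)$ is the space of (real) harmonic functions on $\mathbb{R}^n_+$ representable as the Poisson integral $v(x)=\frac{2}{\omega_n}\int_{\mathbb{R}^{n-1}}\frac{x_n}{|y-x|^n}v(y')\,dy'$ with boundary values $v(y')$ in $L^p(\mathbb{R}^{n-1})$, and $\|v\|_p$ is the $L^p(\mathbb{R}^{n-1})$-norm of the boundary values. For $p=\infty$, $(n-1)/p=0$. ''Sharp'' means the smallest constant for which the inequality holds for all admissible $f_1\in L^p(\mathbb{R}^{n-1})$ (respectively all $v\in h^p(\mathbb{R}^n_+)$). *)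

(* Defs.v *)
From HB Require Import structures.
From mathcomp Require Import all_boot all_order all_algebra.
From mathcomp Require Import all_classical all_reals all_analysis.
Import Order.TTheory GRing.Theory Num.Theory.
Import numFieldNormedType.Exports.

Set Implicit Arguments.
Unset Strict Implicit.
Unset Printing Implicit Defensive.

Local Open Scope classical_set_scope.
Local Open Scope ring_scope.

(* Throughout, n = m.+1 >= 1 is the dimension of the ambient space R^n, whose
   points are row vectors in 'rV[R]_m.+1, and m = n - 1 is the dimension of the
   boundary hyperplane, whose points y' are m-tuples of reals. *)

Section LebesgueTuple.
Variable R : realType.
Local Notation RM := (measurableTypeR R).

Definition cons_pair (m : nat) (z : RM * m.-tuple RM) : m.+1.-tuple RM :=
  [tuple of z.1 :: z.2].

Lemma measurable_cons_pair (m : nat) : measurable_fun [set: _] (@cons_pair m).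
Proof. exact: measurable_cons. Qed.

Section Step.
Variables (m : nat) (mu : {measure set (m.-tuple RM) -> \bar R}).

Definition lebesgue_cons : set (m.+1.-tuple RM) -> \bar R :=
  pushforward (@lebesgue_measure R \x^ mu)%E (@cons_pair m).

Let pre_mble (A : set (m.+1.-tuple RM)) :
  measurable A -> measurable (@cons_pair m @^-1` A).
Proof. by move=> mA; rewrite -[X in measurable X]setTI; exact: measurable_cons_pair. Qed.

Let lebesgue_cons0 : lebesgue_cons set0 = 0%E.
Proof. by rewrite /lebesgue_cons /pushforward preimage_set0 measure0. Qed.

Let lebesgue_cons_ge0 A : (0 <= lebesgue_cons A)%E.
Proof. by rewrite /lebesgue_cons /pushforward; exact: measure_ge0. Qed.

Let lebesgue_cons_sigma_additive : semi_sigma_additive lebesgue_cons.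
Proof.
move=> F mF tF mUF; rewrite /lebesgue_cons /pushforward preimage_bigcup.
apply: measure_semi_sigma_additive.
- by move=> k; exact: pre_mble.
- apply/trivIsetP => /= i j _ _ ij; rewrite -preimage_setI.
  by move/trivIsetP : tF => /(_ _ _ _ _ ij) ->//; rewrite preimage_set0.
- by rewrite -preimage_bigcup; exact: pre_mble.
Qed.

HB.instance Definition _ := isMeasure.Build _ _ _ lebesgue_cons
  lebesgue_cons0 lebesgue_cons_ge0 lebesgue_cons_sigma_additive.

End Step.

Fixpoint lebesgue_tuple_rec (m : nat) : {measure set (m.-tuple RM) -> \bar R} :=
  match m with
  | 0 => \d_[tuple]
  | k.+1 => lebesgue_cons (lebesgue_tuple_rec k)
  end.

(* m-dimensional Lebesgue measure, on the Borel sigma-algebra of R^m; see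
   lebesgue_tuple_box. *)
Definition lebesgue_tuple (m : nat) : set (m.-tuple RM) -> \bar R :=
  lebesgue_tuple_rec m.

Arguments lebesgue_tuple m : clear implicits.

HB.instance Definition _ (m : nat) := Measure.on (lebesgue_tuple m).

Lemma lebesgue_tuple_box (m : nat) (A : 'I_m -> set RM) :
  (forall i, measurable (A i)) ->
  lebesgue_tuple m [set y : m.-tuple RM | forall i, A i (tnth y i)]
  = (\prod_(i < m) lebesgue_measure (A i))%E.
Proof.
elim: m A => [|m IH] A mA.
  rewrite big_ord0 /lebesgue_tuple /= diracE mem_set//=.
  by case.
rewrite big_ord_recl -(IH (A \o lift ord0) (fun i => mA _)) /lebesgue_tuple /=.
rewrite /lebesgue_cons /pushforward -product_measure2E//; last first.
  rewrite (_ : mkset _ = \bigcap_(i in [set: 'I_m])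
      ((fun y : m.-tuple RM => tnth y i) @^-1` A (lift ord0 i))).
    apply: fin_bigcap_measurable => // i _; rewrite -[X in measurable X]setTI.
    exact: measurable_tnth.
  by apply/seteqP; split => [y yA i _|y yA i]; exact: yA.
congr (_ _); apply/seteqP; split => -[a y] /= H.
  by split=> [|i]; [exact: (H ord0)|have := H (lift ord0 i); rewrite tnthS].
case: H => Ha Hy i; case: (unliftP ord0 i) => [j ->|-> //].
by rewrite tnthS; exact: Hy.
Qed.

End LebesgueTuple.

Arguments lebesgue_tuple R m : clear implicits.

Section HalfSpace.
Variables (R : realType) (m : nat).
Local Notation point := ('rV[R]_m.+1).
Local Notation boundary := (m.-tuple (measurableTypeR R)).
Implicit Types (x z : point) (y : boundary) (u v : point -> R) (f g : boundary -> R).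

Definition height x : R := x ord0 ord_max.

Definition half_space : set point := [set x | 0 < height x].

(* (y', 0): the default value of nth supplies the last coordinate *)
Definition boundary_point y : point := \row_(i < m.+1) nth 0 y i.

(* the library norm `|x| of a row vector is the sup norm *)
Definition euclidean_norm x : R := Num.sqrt (\sum_(i < m.+1) x ord0 i ^+ 2).

Definition basis_vector (i : 'I_m.+1) : point := delta_mx ord0 i.

Definition has_gradient u x : Prop :=
  forall i, derivable u x (basis_vector i).

Definition gradient u x : point := \row_(i < m.+1) 'D_(basis_vector i) u x.

(* Harmonic on the half-space: of class C^2 (existence and continuity of the
   second partial derivatives give those of the lower-order ones) with zero
   Laplacian. The values of v outside the half-space are irrelevant. *)
Definition harmonic v : Prop :=
  forall x, half_space x ->
    (forall i j, [/\ derivable v x (basis_vector i),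
       derivable ('D_(basis_vector i) v) x (basis_vector j) &
       {for x, continuous ('D_(basis_vector j) ('D_(basis_vector i) v))}]) /\
    \sum_(i < m.+1) 'D_(basis_vector i) ('D_(basis_vector i) v) x = 0.

Definition Gamma (a : R) : R :=
  \int[lebesgue_measure]_(t in `]0, +oo[) (t `^ (a - 1) * expR (- t)).

(* omega_n for n = m.+1, the area of the unit sphere of R^n *)
Definition sphere_area : R :=
  2 * pi `^ (m.+1%:R / 2) / Gamma (m.+1%:R / 2).

Definition poisson_integral f x : R :=
  2 / sphere_area * \int[lebesgue_tuple R m]_y
    (height x / euclidean_norm (boundary_point y - x) ^+ m.+1 * f y).

(* Explicit solution w of the first boundary value problem for the biharmonic
   equation with w = 0 and dw/dx_n = f on the boundary. The L^p norm of the
   boundary values of dw/dx_n is therefore Lp_norm p f. *)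
Definition biharmonic_solution f x : R :=
  2 / sphere_area * \int[lebesgue_tuple R m]_y
    (height x ^+ 2 / euclidean_norm (boundary_point y - x) ^+ m.+1 * f y).

Definition Lp (p : \bar R) : set (boundary -> R) :=
  [set f | f \in Lfun (lebesgue_tuple R m) p].

Definition Lp_norm (p : \bar R) f : R :=
  fine (Lnorm (lebesgue_tuple R m) p (EFin \o f)).

(* The space h^p, each element v being paired with (a representative of) its
   boundary values, so that the norm of v is Lp_norm p of the second
   component. *)
Definition hp (p : \bar R) : set ((point -> R) * (boundary -> R)) :=
  [set vg | [/\ Lp p vg.2, harmonic vg.1 &
     forall x, half_space x -> vg.1 x = poisson_integral vg.2 x]].

(* (n - 1) / p, which is 0 for p = +oo *)
Definition codim_over (p : \bar R) : R :=
  match p with r%:E => m%:R / r | _ => 0 end.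

(* C is the smallest constant such that
   |grad (u a) (x)| <= C * b a for every admissible a; the gradients involved
   are required to exist. *)
Definition sharp_gradient_constant (T : Type) (A : set T)
    (u : T -> point -> R) (b : T -> R) x (C : R) : Prop :=
  [/\ forall a, A a -> has_gradient (u a) x,
      forall a, A a -> euclidean_norm (gradient (u a) x) <= C * b a &
      forall C', (forall a, A a ->
        euclidean_norm (gradient (u a) x) <= C' * b a) -> C <= C'].

End HalfSpace.

(* Main.v *)
From HB Require Import structures.
Require Import Defs.
From mathcomp Require Import all_boot all_order all_algebra all_fingroup.
From mathcomp Require Import all_classical all_reals all_analysis.
From mathcomp Require Import measurable_realfun ess_sup_inf.
From mathcomp Require Import ring lra.
Import Order.TTheory GRing.Theory Num.Theory.
Import numFieldNormedType.Exports.

Set Implicit Arguments.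
Unset Strict Implicit.
Unset Printing Implicit Defensive.

Local Open Scope classical_set_scope.
Local Open Scope ring_scope.

(** Let r = |y - x| be the distance from x to the boundary point y, h the height
    of x, n = m + 1, c = 2 / omega_n, and Q f (x) the integral of r^(-n) f(y)
    over y. On the half-space the Poisson integral of f is c h Q f and the
    biharmonic solution is c h^2 Q f. After multiplication by h^(n alpha - 1),
    respectively h^(n alpha - 2), both become c h^b Q f with b = n alpha. Every
    Poisson integral of an L^p datum is harmonic ([harmonic_poisson]), so the two
    inequalities compare the same functions with the same norms.

    Differentiating under the integral sign ([is_derive_tame_integral]), the i-th
    partial derivative of c h^b Q f is c h^(b - 1) times the integral of f against
    (b delta_in - n d_n d_i) r^(-n), where d = (y - x) / r
    ([gradient_power_potential]). This kernel is homogeneous: the similarity that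
    carries the point apex = (0, ..., 0, 1) to x multiplies the gradient and the
    L^p norm by powers of h ([gradient_field_chart], [Lp_dilate]), which are those
    of the statement. The sharp constant is therefore the same at all points: it is
    the supremum of |gradient at apex| / |f|_p ([sharp_constant]). It is finite
    because the L^p norm of f controls the integral of r^(-n) |f|
    ([weighted_L1_bound]).

    For p = oo, c r^(-n) dy at apex is a probability measure
    ([poisson_normalization]) under which the unit vector d has second moments
    E (d_i d_j) = delta_ij / n ([second_moment]): the constancy of the Poisson
    integral of 1 gives the moments that involve d_n, the symmetries of the boundary
    give the others. The derivative in a unit direction z has density
    b z_n - n d_n (d.z). For b = 0 its absolute value is at most
    n (d_n^2 + (d.z)^2) / 2, of mean 1. For b = n it is n times the inner product of
    the projections of e_n and z orthogonal to d, hence at most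
    n (2 - d_n^2 - (d.z)^2) / 2, of mean n - 1. Both bounds are attained by f = 1,
    for which c h^b Q f = h^(b - 1) has a gradient of length |b - 1| at apex. *)

(** * Maps that multiply a measure by a constant *)

Section ScaledMeasure.
Context d (T : measurableType d) (R : realType).
Variables (mu : {measure set T -> \bar R}) (phi : T -> T) (c : R).
Hypotheses (mphi : measurable_fun [set: T] phi) (c0 : 0 <= c).
Hypothesis muphi : forall A, measurable A -> mu (phi @^-1` A) = (c%:E * mu A)%E.

(** The image of [mu] under [phi] is [c] times [mu], and both sides are integrals
    against it. *)
Lemma ge0_integral_scaled (f : T -> \bar R) : measurable_fun [set: T] f ->
  (forall y, 0 <= f y)%E ->
  (\int[mu]_y f (phi y) = c%:E * \int[mu]_y f y)%E.
Proof.
move=> mf f0.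
transitivity (\int[pushforward mu phi]_y f y)%E.
  by rewrite ge0_integral_pushforward.
rewrite [LHS](eq_measure_integral (mscale (NngNum c0) mu)); last first.
  by move=> A mA _; exact: muphi.
by rewrite ge0_integral_mscale.
Qed.

Lemma integrable_scaled (f : T -> R) :
  mu.-integrable [set: T] (EFin \o f) ->
  mu.-integrable [set: T] (EFin \o (f \o phi)).
Proof.
move=> /integrableP[mf foo]; apply/integrableP; split.
  by apply: (measurableT_comp mf mphi).
rewrite (ge0_integral_scaled (f := fun y => `|(EFin \o f) y|%E)) //.
  by rewrite lte_mul_pinfty.
exact: measurableT_comp.
Qed.

Lemma Rintegral_scaled (f : T -> R) :
  mu.-integrable [set: T] (EFin \o f) ->
  \int[mu]_y f (phi y) = c * \int[mu]_y f y.
Proof.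
move=> intf; have /integrableP[mf _] := intf.
rewrite /Rintegral [in RHS]integralE.
rewrite [X in fine X = _]integralE.
under [X in fine (X - _)%E = _]eq_integral do rewrite (funepos_comp (EFin \o f) phi)/=.
under [X in fine (_ - X)%E = _]eq_integral do rewrite (funeneg_comp (EFin \o f) phi)/=.
rewrite !ge0_integral_scaled//; last 2 first.
- exact: measurable_funeneg.
- exact: measurable_funepos.
have := integrable_fin_num measurableT (integrable_funepos measurableT intf).
have := integrable_fin_num measurableT (integrable_funeneg measurableT intf).
move=> /fineK <- /fineK <-.
by rewrite -!EFinM -!EFinB/= mulrBr.
Qed.

End ScaledMeasure.

(** * Lebesgue measure under affine maps *)

Section AffineMeasure.
Variable R : realType.
Local Notation RM := (measurableTypeR R).
Local Notation lambda := (@lebesgue_measure R).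

Lemma measurable_affine (a b : R) :
  measurable_fun [set: RM] (fun x : RM => (a * x + b : RM)).
Proof. by apply: measurable_funD => //; exact: measurable_funM. Qed.

(** Up to the factor, both sides are measures in [A] that agree on the intervals
    ]c, d]. *)
Lemma lebesgue_measure_affine (a b : R) (A : set RM) : a != 0 -> measurable A ->
  lambda ((fun x : RM => (a * x + b : RM)) @^-1` A) = (`|a|^-1%:E * lambda A)%E.
Proof.
move=> a0 mA.
have na0 : 0 < `|a| by rewrite normr_gt0.
pose T (x : RM) : RM := a * x + b.
pose r : {nonneg R} := NngNum (ltW na0).
suff -> : lambda A = (`|a|%:E * lambda (T @^-1` A))%E.
  by rewrite muleA -EFinM mulVf ?gt_eqF// mul1e.
apply: (@lebesgue_measure_unique _ (mscale r (pushforward lambda T))) => //;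
  first exact: measurable_affine.
move=> mT _ [[c d]] _ <-; rewrite -[RHS]/(`|a|%:E * lambda (T @^-1` _))%E.
have [a_gt0|a_lt0|/eqP] := ltgtP 0 a; last by rewrite eq_sym (negbTE a0).
  rewrite (_ : T @^-1` _ = `](c - b) / a, (d - b) / a]%classic); last first.
    apply/seteqP; split=> x /=; rewrite !in_itv/= /T ltr_pdivrMr// ler_pdivlMr//;
      by rewrite ltrBlDr lerBrDr mulrC.
  rewrite !lebesgue_measure_itv/= !lte_fin ltr_pM2r ?invr_gt0// ltrD2r.
  case: ifPn => _; last by rewrite mule0.
  rewrite -!EFinB -EFinM gtr0_norm//; congr _%:E.
  by field; rewrite gt_eqF.
rewrite (_ : T @^-1` _ = `[(d - b) / a, (c - b) / a[%classic); last first.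
  apply/seteqP; split=> x /=; rewrite !in_itv/= /T ltr_ndivlMr// ler_ndivrMr//;
    by rewrite ltrBlDr lerBrDr mulrC andbC.
rewrite !lebesgue_measure_itv/= !lte_fin ltr_nM2r ?invr_lt0// ltrD2r.
case: ifPn => _; last by rewrite mule0.
rewrite -!EFinB -EFinM ltr0_norm//; congr _%:E.
by field; rewrite lt_eqF.
Qed.

End AffineMeasure.

Section TupleMeasure.
Variables (R : realType) (m : nat).
Local Notation RM := (measurableTypeR R).
Local Notation boundary := (m.-tuple RM).
Local Notation lambda := (@lebesgue_measure R).
Local Notation tlambda := (lebesgue_tuple R m).

Definition box (A : 'I_m -> set RM) : set boundary :=
  [set y | forall i, A i (tnth y i)].

Lemma measurable_box (A : 'I_m -> set RM) :
  (forall i, measurable (A i)) -> measurable (box A).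
Proof.
move=> mA; rewrite (_ : box A = \bigcap_(i in [set: 'I_m])
    ((fun y : boundary => tnth y i) @^-1` A i)).
  apply: fin_bigcap_measurable => // i _; rewrite -[X in measurable X]setTI.
  exact: measurable_tnth.
by apply/seteqP; split => [y yA i _|y yA i]; exact: yA.
Qed.

Definition cube (k : nat) : set boundary := box (fun=> `[- k%:R, k%:R]%classic).

Lemma bigcup_cube : \bigcup_k cube k = [set: boundary].
Proof.
apply/seteqP; split=> // y _.
have s0 : 0 <= \sum_(i < m) `|tnth y i| by exact: sumr_ge0.
exists (Num.truncn (\sum_(i < m) `|tnth y i|)).+1 => // i /=.
rewrite in_itv/= -ler_norml (le_trans _ (ltW (truncnS_gt _)))//.
by rewrite (bigD1 i)//= lerDl sumr_ge0.
Qed.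

Lemma lebesgue_tuple_cube k : tlambda (cube k) = ((k%:R + k%:R) ^+ m)%:E.
Proof.
rewrite lebesgue_tuple_box//.
under eq_bigr => i _.
  rewrite lebesgue_measure_itv/= lte_fin (_ : (if _ then _ else _) = (k%:R + k%:R)%:E).
  over.
  case: ltrP => [_|k0]; first by rewrite -EFinD opprK.
  congr _%:E; have : 0 <= k%:R :> R by []. lra.
by rewrite prodEFin prodr_const card_ord.
Qed.

Lemma sigma_finite_lebesgue_tuple : sigma_finite [set: boundary] tlambda.
Proof.
exists cube; first by rewrite bigcup_cube.
move=> k; split; first exact: measurable_box.
by rewrite lebesgue_tuple_cube ltry.
Qed.

HB.instance Definition _ := Measure_isSigmaFinite.Build _ _ _ tlambda
  sigma_finite_lebesgue_tuple.

(** Boxes with measurable sides are stable under intersection and generate the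
    sigma-algebra, and the cubes, of finite measure, exhaust the space. *)
Lemma lebesgue_tuple_unique (mu : {measure set boundary -> \bar R}) :
  (forall A : 'I_m -> set RM, (forall i, measurable (A i)) ->
    mu (box A) = (\prod_(i < m) lambda (A i))%E) ->
  forall X, measurable X -> mu X = tlambda X.
Proof.
move=> muE; pose G := [set B | exists2 A : 'I_m -> set RM,
  (forall i, measurable (A i)) & B = box A].
move=> X mX; apply/esym; apply: (measure_unique G cube) => //.
- apply/seteqP; split; last first.
    apply: smallest_sub; first exact: sigma_algebra_measurable.
    by move=> _ [A mA ->]; exact: measurable_box.
  apply: smallest_sub; first exact: smallest_sigma_algebra.
  rewrite -bigcup_seq => B [i _ [A mA <-]]; apply: sub_sigma_algebra.
  exists (fun j => if j == i then A else setT).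
    by move=> j; case: ifPn.
  rewrite setTI; apply/seteqP; split=> y /=.
    by move=> yA j; case: eqVneq => // ->.
  by move=> /(_ i); rewrite eqxx.
- move=> _ _ [A mA ->] [B mB ->]; exists (fun i => A i `&` B i).
    by move=> i; exact: measurableI.
  apply/seteqP; split=> y /=; first by move=> [yA yB] i; split.
  by move=> yAB; split => i; have [] := yAB i.
- by move=> k; exists (fun=> `[- k%:R, k%:R]%classic).
- exact: bigcup_cube.
- by move=> _ [A mA ->]; rewrite muE// -lebesgue_tuple_box.
- by move=> k; rewrite -[X in (X < _)%E]/(tlambda _) lebesgue_tuple_cube ltry.
Qed.

(** A single family that contains the translations and dilations of the boundary,
    the reflections in a coordinate and the exchanges of two coordinates. *)
Definition affine_perm (s : {perm 'I_m}) (a b : 'I_m -> R) (y : boundary) : boundary :=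
  [tuple (a i * tnth y (s i) + b i : RM) | i < m].

Lemma measurable_affine_perm s a b : measurable_fun [set: boundary] (affine_perm s a b).
Proof.
apply/measurable_fun_tnthP => i.
rewrite (_ : _ \o _ = (fun x => a i * x + b i) \o (@tnth _ RM ^~ (s i))).
  by apply: measurableT_comp; [exact: measurable_affine|exact: measurable_tnth].
by apply/funext => y /=; rewrite tnth_mktuple.
Qed.

(** The preimage of a box is the box of the preimages of its sides under affine
    maps of one variable. *)
Lemma lebesgue_tuple_affine_perm s a b (X : set boundary) :
  (forall i, a i != 0) -> measurable X ->
  tlambda (affine_perm s a b @^-1` X)
  = ((\prod_(i < m) `|a i|^-1)%:E * tlambda X)%E.
Proof.
move=> a0 mX.
have c0 : 0 < \prod_(i < m) `|a i|.
  by apply: prodr_gt0 => i _; rewrite normr_gt0.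
pose r : {nonneg R} := NngNum (ltW c0).
suff <- : ((\prod_(i < m) `|a i|)%:E * tlambda (affine_perm s a b @^-1` X) = tlambda X)%E.
  by rewrite muleA -EFinM prodfV mulVf ?gt_eqF// mul1e.
have := @lebesgue_tuple_unique (mscale r (pushforward tlambda (affine_perm s a b))).
move=> /(_ (measurable_affine_perm s a b)); apply => //.
move=> A mA; rewrite -[LHS]/((\prod_(i < m) `|a i|)%:E * tlambda (affine_perm s a b @^-1` _))%E.
(* the coordinate of index s i is constrained by the i-th side *)
pose B i := (fun x : RM => (a (s^-1%g i) * x + b (s^-1%g i) : RM)) @^-1` A (s^-1%g i).
have -> : affine_perm s a b @^-1` box A = box B.
  apply/seteqP; split => y /= H i.
    by have := H (s^-1%g i); rewrite /= tnth_mktuple permKV.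
  by have := H (s i); rewrite /= /B /= tnth_mktuple permK.
rewrite (@lebesgue_tuple_box _ _ B); last first.
  by move=> i; rewrite -[X in measurable X]setTI; exact: measurable_affine.
have BE i : lambda (B i) = (`|a (s^-1%g i)|^-1%:E * lambda (A (s^-1%g i)))%E.
  exact: lebesgue_measure_affine.
rewrite (eq_bigr _ (fun i _ => BE i)).
rewrite [X in (_ * X)%E](reindex_inj (@perm_inj _ s))/=.
rewrite (eq_bigr (fun i => (`|a i|^-1%:E * lambda (A i))%E)); last first.
  by move=> i _; rewrite permK.
rewrite big_split/= prodEFin muleA -EFinM prodfV mulfV ?gt_eqF// mul1e//.
Qed.

End TupleMeasure.

(** * The Gamma function and the total mass of the Poisson kernel *)

Section Normalization.
Variable R : realType.
Local Notation RM := (measurableTypeR R).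
Local Notation lambda := (@lebesgue_measure R).
Local Notation halfline := (`]0, +oo[%classic : set RM).

(** The Gamma integral with values in the extended reals. The real number [Gamma s]
    carries information only when this integral is finite, which comes out of
    [poisson_gammaE] for the argument that occurs in [sphere_area]. *)
Definition gammaE (s : R) : \bar R :=
  (\int[lambda]_(t in halfline) (t `^ (s - 1) * expR (- t))%:E)%E.

Lemma Gamma_gammaE s : Gamma s = fine (gammaE s).
Proof. by []. Qed.

Lemma integral_indic_mulr (D : set RM) (f : RM -> R) :
  (\int[lambda]_(t in D) (f t)%:E = \int[lambda]_t (f t * \1_D t)%:E)%E.
Proof.
rewrite integral_mkcond; apply: eq_integral => t _.
rewrite patchE indicE; case: ifPn => _; first by rewrite mulr1.
by rewrite mulr0.
Qed.

Lemma measurable_gamma_density (s : R) :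
  measurable_fun [set: RM] (fun t : RM => t `^ (s - 1) * expR (- t)).
Proof.
apply: measurable_funM; first exact: measurable_powR.
by apply: measurableT_comp => //; exact: measurable_oppr.
Qed.

Lemma ge0_integral_dilation (a : R) (f : RM -> \bar R) : 0 < a ->
  measurable_fun [set: RM] f -> (forall x, 0 <= f x)%E ->
  (\int[lambda]_x f (a * x)%R = a^-1%:E * \int[lambda]_x f x)%E.
Proof.
move=> a0 mf f0; rewrite -(@ge0_integral_scaled _ _ _ _ (fun x : RM => a * x + 0 : RM)) //.
- by apply: eq_integral => x _; rewrite addr0.
- exact: measurable_affine.
- by rewrite invr_ge0 ltW.
- move=> A mA; have := lebesgue_measure_affine 0 (lt0r_neq0 a0) mA.
  by rewrite gtr0_norm.
Qed.

Lemma gammaE_dilation (s a : R) : 0 < a ->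
  (\int[lambda]_(t in halfline) (t `^ (s - 1) * expR (- (t * a)))%:E
   = (a `^ (- s))%:E * gammaE s)%E.
Proof.
move=> a0; rewrite /gammaE !(integral_indic_mulr halfline).
pose g (t : RM) : R := t `^ (s - 1) * expR (- t) * \1_halfline t.
have mg : measurable_fun [set: RM] g.
  by apply: measurable_funM; [exact: measurable_gamma_density|exact: measurable_indic].
have g0 t : 0 <= g t by rewrite !mulr_ge0 ?powR_ge0 ?expR_ge0.
rewrite -/g (_ : a `^ (- s) = (a `^ (s - 1))^-1 * a^-1); last first.
  rewrite powRB; last by rewrite lt0r_neq0 ?implybT.
  by rewrite powRr1 ?ltW// powRN; field; rewrite !gt_eqF// powR_gt0.
rewrite EFinM -muleA -(@ge0_integral_dilation a (fun t => (g t)%:E))//; last exact/measurable_EFinP.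
rewrite -ge0_integralZl//; last 3 first.
- apply/measurable_EFinP; apply: (measurableT_comp mg).
  exact: (@measurable_funM _ _ _ _ (cst a) id).
- by move=> t _; rewrite lee_fin.
- by rewrite lee_fin invr_ge0 powR_ge0.
apply: eq_integral => t _; rewrite -EFinM; congr _%:E; rewrite /g !indicE.
rewrite !mem_setE !in_itv/= !andbT pmulr_rgt0//.
have [t0|] := ltrP 0 t; last by rewrite !mulr0.
rewrite !mulr1 powRM ?ltW// [a * t]mulrC; field.
by rewrite gt_eqF// powR_gt0.
Qed.

(** Write each power of [N] as a Gamma integral by [gammaE_dilation] and exchange
    the integrations. For N = 1 + |y|^2 the inner integral on the right is Gaussian. *)
Lemma gamma_tonelli d (T : measurableType d) (mu : {sigma_finite_measure set T -> \bar R})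
    (N : T -> R) (s : R) : measurable_fun [set: T] N -> (forall y, 0 < N y) ->
  ((\int[mu]_y (N y `^ (- s))%:E) * gammaE s
   = \int[lambda]_(t in halfline) ((t `^ (s - 1))%:E * \int[mu]_y (expR (- (t * N y)))%:E))%E.
Proof.
move=> mN N0.
have gE0 : (0 <= gammaE s)%E.
  by apply: integral_ge0 => t _; rewrite lee_fin mulr_ge0 ?powR_ge0 ?expR_ge0.
have mNs : measurable_fun [set: T] (fun y => N y `^ (- s)).
  exact: (measurableT_comp (measurable_powR _) mN).
rewrite -ge0_integralZr//; last 2 first.
- exact/measurable_EFinP.
- by move=> y _; rewrite lee_fin powR_ge0.
pose F (z : RM * T) : \bar R :=
  (z.1 `^ (s - 1) * expR (- (z.1 * N z.2)) * \1_halfline z.1)%:E.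
have mF : measurable_fun [set: RM * T] F.
  apply/measurable_EFinP/measurable_funM.
    apply: measurable_funM.
      exact: (measurableT_comp (measurable_powR _) measurable_fst).
    apply: measurableT_comp => //; apply: measurableT_comp => //.
    by apply: measurable_funM => //; exact: (measurableT_comp mN).
  by apply: (measurableT_comp (measurable_indic _)).
have F0 z : (0 <= F z)%E by rewrite lee_fin !mulr_ge0 ?powR_ge0 ?expR_ge0.
transitivity (\int[mu]_y \int[lambda]_t F (t, y))%E.
  apply: eq_integral => y _.
  by rewrite -gammaE_dilation// integral_indic_mulr.
rewrite -(fubini_tonelli (m1 := lambda) (m2 := mu) F)// [RHS]integral_mkcond.
apply: eq_integral => t _; rewrite patchE /F/= indicE.
case: ifPn => _; last first.
  by rewrite integral0_eq// => y _; rewrite mulr0.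
rewrite -ge0_integralZl//.
- by apply: eq_integral => y _; rewrite mulr1.
- apply/measurable_EFinP; apply: measurableT_comp => //; apply: measurableT_comp => //.
  exact: measurable_funM.
- by rewrite lee_fin powR_ge0.
Qed.

Lemma integral_gauss_dilation (t : R) : 0 < t ->
  (\int[lambda]_x (expR (- (t * x ^+ 2)))%:E = (Num.sqrt pi * t `^ (- 2^-1))%:E)%E.
Proof.
move=> t0; have st0 : 0 < Num.sqrt t by rewrite sqrtr_gt0.
transitivity (\int[lambda]_x (gauss_fun (Num.sqrt t * x))%:E)%E.
  by apply: eq_integral => x _; rewrite /gauss_fun exprMn sqr_sqrtr ?ltW.
rewrite (@ge0_integral_dilation _ (fun x => (gauss_fun x)%:E))//.
- rewrite integralT_gauss -EFinM mulrC; congr (_ * _)%:E.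
  by rewrite powRN powR12_sqrt ?ltW.
- by apply/measurable_EFinP; apply: measurable_gauss_fun.
- by move=> x; rewrite lee_fin gauss_fun_ge0.
Qed.

Lemma gammaE1 : gammaE 1 = 1%E.
Proof.
rewrite /gammaE -(integral_exponential_pdf (@ltr01 R)) integral_indic_mulr.
rewrite [RHS](_ : _ = \int[lambda]_(t in `[0%R, +oo[) (1 * expR (- 1 * t))%:E)%E; last first.
  rewrite [RHS]integral_mkcond; apply: eq_integral => t _.
  by rewrite /exponential_pdf /patch; case: ifPn.
rewrite -integral_indic_mulr.
rewrite -[RHS]integral_itv_obnd_cbnd; last first.
  apply/measurable_EFinP/measurable_funTS; apply: measurable_funM => //.
  by apply: measurableT_comp => //; exact: measurable_funM.
by apply: eq_integral => t _; rewrite subrr powRr0 mulN1r.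
Qed.

Lemma integral_oneDsqr : (\int[lambda]_x ((1 + x ^+ 2)^-1)%:E = pi%:E)%E.
Proof.
rewrite (@ge0_symfun_integralT _ (fun x => (1 + x ^+ 2)^-1))//.
- rewrite (_ : [set x | _] = `[0, +oo[%classic); last first.
    by apply/seteqP; split => x/=; rewrite in_itv/= andbT.
  by rewrite integral0y_oneDsqr -EFinM mulrCA divff// mulr1.
- by move=> x; rewrite invr_ge0 addr_ge0// sqr_ge0.
- exact: continuous_oneDsqrV.
- by move=> x /=; rewrite sqrrN.
Qed.

(** This is [gamma_tonelli] for s = 1 and N = 1 + x^2 on the line: the left side is
    the integral of 1 / (1 + x^2), that is pi, and the right side is sqrt pi times
    the Gamma integral at 1/2. *)
Lemma gammaE_half : gammaE 2^-1 = (Num.sqrt pi)%:E.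
Proof.
have pi0 : 0 < Num.sqrt (pi : R) by rewrite sqrtr_gt0 pi_gt0.
have N0 (x : RM) : 0 < 1 + x ^+ 2 by rewrite ltr_wpDr ?sqr_ge0.
have mN : measurable_fun [set: RM] (fun x : RM => 1 + x ^+ 2).
  by apply: measurable_funD => //; exact: measurable_funX.
have := gamma_tonelli lambda 1 mN N0.
rewrite gammaE1 mule1.
under eq_integral do rewrite powR_inv1 ?ltW//.
rewrite integral_oneDsqr => H.
have : (pi%:E = (Num.sqrt pi)%:E * gammaE 2^-1)%E.
  rewrite H /gammaE -ge0_integralZl//; last 2 first.
  - by apply/measurable_EFinP; apply: measurable_funTS; exact: measurable_gamma_density.
  - by move=> t _; rewrite lee_fin mulr_ge0 ?powR_ge0 ?expR_ge0.
  apply: eq_integral => t; rewrite inE/= in_itv/= andbT => t0.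
  rewrite subrr powRr0 mul1e.
  under eq_integral do rewrite mulrDr mulr1 opprD expRD EFinM.
  rewrite ge0_integralZl//; last first.
  - apply/measurable_EFinP; apply: measurableT_comp => //; apply: measurableT_comp => //.
    by apply: measurable_funM => //; exact: measurable_funX.
  rewrite integral_gauss_dilation// -!EFinM; congr _%:E.
  by rewrite (_ : 2^-1 - 1 = - 2^-1 :> R); [ring|field].
move=> /(congr1 (fun z => (Num.sqrt pi)^-1%:E * z)%E).
rewrite muleA -!EFinM mulVf ?gt_eqF// mul1e => <-; congr _%:E.
by rewrite -{2}(sqr_sqrtr (pi_ge0 R)); field; rewrite gt_eqF.
Qed.

Definition sqnorm (m : nat) (y : m.-tuple RM) : R := \sum_(i < m) tnth y i ^+ 2.

Lemma sqnorm_ge0 m (y : m.-tuple RM) : 0 <= sqnorm y.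
Proof. by apply: sumr_ge0 => i _; exact: sqr_ge0. Qed.

Lemma measurable_sqnorm m : measurable_fun [set: m.-tuple RM] (@sqnorm m).
Proof.
by apply: measurable_sum => i; apply: measurable_funX; exact: measurable_tnth.
Qed.

Lemma lebesgue_tuple_tonelli m (f : m.+1.-tuple RM -> \bar R) :
  measurable_fun [set: _] f -> (forall y, 0 <= f y)%E ->
  (\int[lebesgue_tuple R m.+1]_y f y
   = \int[lebesgue_tuple R m]_y \int[lambda]_x f (cons_pair (x, y)))%E.
Proof.
move=> mf f0.
transitivity (\int[(lambda \x^ lebesgue_tuple R m)%E]_z f (cons_pair z))%E.
  exact: (ge0_integral_pushforward (@measurable_cons_pair R m)).
have mfc : measurable_fun [set: RM * m.-tuple RM] (f \o @cons_pair R m).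
  exact: (measurableT_comp mf (@measurable_cons_pair R m)).
rewrite -(fubini_tonelli2 (m1 := lambda) (m2 := lebesgue_tuple R m) (f \o @cons_pair R m))//;
  last by move=> z; exact: f0.
apply: eq_measure_integral => A mA _; apply/esym.
apply: product_measure_unique => // B C mB mC; exact: product_measure2E.
Qed.

Lemma integral_tuple_gauss m (t : R) : 0 < t ->
  (\int[lebesgue_tuple R m]_y (expR (- (t * sqnorm y)))%:E
   = ((Num.sqrt pi * t `^ (- 2^-1)) ^+ m)%:E)%E.
Proof.
have mE (k : nat) : measurable_fun [set: k.-tuple RM]
    (fun y => (expR (- (t * sqnorm y)))%:E).
  apply/measurable_EFinP; apply: measurableT_comp => //; apply: measurableT_comp => //.
  by apply: measurable_funM => //; exact: measurable_sqnorm.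
move=> t0; elim: m => [|m IH].
  rewrite /lebesgue_tuple integral_dirac//=; last exact: mE.
  by rewrite expr0 /sqnorm big_ord0 mulr0 oppr0 expR0 diracE mem_set// mul1e.
rewrite lebesgue_tuple_tonelli//.
transitivity (\int[lebesgue_tuple R m]_y
    ((Num.sqrt pi * t `^ (- 2^-1))%:E * (expR (- (t * sqnorm y)))%:E))%E.
  apply: eq_integral => y _; rewrite -integral_gauss_dilation// -ge0_integralZr//.
  - apply: eq_integral => x _; rewrite /sqnorm big_ord_recl mulrDr opprD expRD EFinM.
    by under eq_bigr do rewrite tnthS.
  - apply/measurable_EFinP; apply: measurableT_comp => //; apply: measurableT_comp => //.
    by apply: measurable_funM => //; exact: measurable_funX.
rewrite ge0_integralZl//.
- by rewrite IH -EFinM exprS.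
- exact: mE.
- by rewrite lee_fin mulr_ge0 ?sqrtr_ge0 ?powR_ge0.
Qed.

(** In [gamma_tonelli] with s = (m + 1) / 2 the Gaussian integral is (pi / t)^(m/2),
    which leaves the Gamma integral at 1/2. *)
Lemma poisson_gammaE m :
  ((\int[lebesgue_tuple R m]_y ((1 + sqnorm y) `^ (- (m.+1%:R / 2)))%:E)
   * gammaE (m.+1%:R / 2) = (Num.sqrt pi ^+ m.+1)%:E)%E.
Proof.
rewrite gamma_tonelli; last 2 first.
- by apply: measurable_funD => //; exact: measurable_sqnorm.
- by move=> y; rewrite ltr_wpDr ?sqnorm_ge0.
transitivity (\int[lambda]_(t in halfline)
    ((Num.sqrt pi ^+ m)%:E * (t `^ (2^-1 - 1) * expR (- t))%:E))%E.
  apply: eq_integral => t; rewrite inE/= in_itv/= andbT => t0.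
  under eq_integral do rewrite mulrDr mulr1 opprD expRD EFinM.
  rewrite ge0_integralZl//; last first.
  - apply/measurable_EFinP; apply: measurableT_comp => //; apply: measurableT_comp => //.
    by apply: measurable_funM => //; exact: measurable_sqnorm.
  rewrite integral_tuple_gauss// -!EFinM; congr _%:E.
  rewrite exprMn -[(t `^ _) ^+ m]powR_mulrn ?powR_ge0// -powRrM.
  rewrite (_ : 2^-1 - 1 = (m.+1%:R / 2 - 1) + (- 2^-1 * m%:R) :> R); last first.
    by rewrite -natr1; field.
  rewrite [t `^ (_ + - 2^-1 * _)]powRD; last by rewrite lt0r_neq0 ?implybT.
  ring.
rewrite ge0_integralZl//.
- by rewrite -/(gammaE _) gammaE_half -EFinM exprSr.
- by apply/measurable_EFinP; apply: measurable_funTS; exact: measurable_gamma_density.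
- by move=> t _; rewrite lee_fin mulr_ge0 ?powR_ge0 ?expR_ge0.
Qed.

(** In [poisson_gammaE] a product of two nonnegative extended reals is finite and
    nonzero, so both factors are. *)
Lemma poisson_normalization m :
  0 < sphere_area R m /\
  (\int[lebesgue_tuple R m]_y ((1 + sqnorm y) `^ (- (m.+1%:R / 2)))%:E
   = (sphere_area R m / 2)%:E)%E.
Proof.
have pi0 : 0 < Num.sqrt (pi : R) by rewrite sqrtr_gt0 pi_gt0.
have J0 : (0 <= \int[lebesgue_tuple R m]_y ((1 + sqnorm y) `^ (- (m.+1%:R / 2)))%:E)%E.
  by apply: integral_ge0 => y _; rewrite lee_fin powR_ge0.
have G0 : (0 <= gammaE (m.+1%:R / 2))%E.
  by apply: integral_ge0 => t _; rewrite lee_fin mulr_ge0 ?powR_ge0 ?expR_ge0.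
rewrite /sphere_area Gamma_gammaE.
have -> : pi `^ (m.+1%:R / 2) = Num.sqrt pi ^+ m.+1 :> R.
  by rewrite mulrC powRrM powR12_sqrt ?pi_ge0// powR_mulrn ?sqrtr_ge0.
have := poisson_gammaE m; have c0 : 0 < Num.sqrt (pi : R) ^+ m.+1 by rewrite exprn_gt0.
move: J0 G0 c0; set c := Num.sqrt _ ^+ _.
case: (gammaE _) => [g| |]//; case: (integral _ _ _) => [j| |]//.
- rewrite !lee_fin /= -EFinM => j0 g0 c0 [jg].
  have g_gt0 : 0 < g by rewrite lt_def g0 andbT; apply: contraTneq c0 => g0'; rewrite -jg g0' mulr0 ltxx.
  split; first by rewrite !mulr_gt0 ?invr_gt0.
  by congr _%:E; rewrite -jg; field; rewrite gt_eqF.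
- move=> _; rewrite lee_fin le_eqVlt => /predU1P[<-|g0] c0.
    by rewrite mule0 => -[/esym/eqP]; rewrite gt_eqF.
  by rewrite gt0_mulye.
- rewrite lee_fin => + _; rewrite le_eqVlt => /predU1P[<-|j0] c0.
    by rewrite mul0e => -[/esym/eqP]; rewrite gt_eqF.
  by rewrite gt0_muley.
Qed.

End Normalization.

(** * Derivatives along lines *)

Section DirectionalDerivatives.
Context (R : realType) (V : normedModType R).
Implicit Types (g : V -> R) (x v : V).

Lemma is_derive_lineP g x v (s dg : R) :
  is_derive (s *: v + x) v g dg <-> is_derive s 1 (fun s : R => g (s *: v + x)) dg.
Proof.
have E : (fun h : R => h^-1 *: (g (h *: v + (s *: v + x)) - g (s *: v + x))) =
    (fun h : R => h^-1 *: (g ((h *: (1 : R) + s) *: v + x) - g (s *: v + x))).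
  by apply/funext => h; rewrite addrA -scalerDl [h *: 1]mulr1.
split=> -[dgx dgE]; apply: DeriveDef.
- by move: dgx; rewrite /derivable/= E.
- by move: dgE; rewrite /derive/= E.
- by rewrite /derivable/= E.
- by rewrite /derive/= E.
Qed.

Lemma is_derive_comp1 (f : R -> R) g x v (a b : R) :
  is_derive (g x) 1 f a -> is_derive x v g b -> is_derive x v (f \o g) (a * b).
Proof.
have E : 0 *: v + x = x by rewrite scale0r add0r.
rewrite -{1 2 3}E => df /is_derive_lineP dg; apply/is_derive_lineP.
exact: (is_derive1_comp df dg).
Qed.

End DirectionalDerivatives.

(** * Distances to boundary points *)

Section Kernel.
Variables (R : realType) (m : nat).
Local Notation RM := (measurableTypeR R).
Local Notation point := ('rV[R]_m.+1).
Local Notation boundary := (m.-tuple RM).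
Local Notation tlambda := (lebesgue_tuple R m).
Local Notation e_ i := (@basis_vector R m i).
Implicit Types (x z : point) (y : boundary) (i j : 'I_m.+1).

Definition offset i x y : R := nth 0 y i - x ord0 i.
Definition dist2 x y : R := \sum_i offset i x y ^+ 2.
Definition inv_dist x y : R := dist2 x y `^ (- 2^-1).

Lemma offset_max x y : offset ord_max x y = - height x.
Proof. by rewrite /offset nth_default ?size_tuple// sub0r. Qed.

Lemma le_of_sqr (a b : R) : 0 <= b -> a ^+ 2 <= b ^+ 2 -> a <= b.
Proof. by move=> b0; case: (lerP a b) => // ba; rewrite leNgt ltrXn2r// gt_eqF. Qed.

Lemma dist2_ge0 x y : 0 <= dist2 x y.
Proof. by apply: sumr_ge0 => i _; exact: sqr_ge0. Qed.

Lemma offset_le_dist2 i x y : offset i x y ^+ 2 <= dist2 x y.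
Proof. by rewrite /dist2 (bigD1 i)//= lerDl sumr_ge0// => j _; exact: sqr_ge0. Qed.

Lemma height_le_dist2 x y : height x ^+ 2 <= dist2 x y.
Proof. by rewrite -[height x ^+ 2]sqrrN -(offset_max x y) offset_le_dist2. Qed.

Lemma dist2_gt0 x y : half_space x -> 0 < dist2 x y.
Proof. by move=> hx; apply: lt_le_trans (height_le_dist2 x y); rewrite exprn_gt0. Qed.

Lemma inv_distE x y : inv_dist x y = (euclidean_norm (boundary_point y - x))^-1.
Proof.
rewrite /inv_dist powRN powR12_sqrt ?dist2_ge0//; congr (Num.sqrt _)^-1.
by apply: eq_bigr => i _; rewrite !mxE.
Qed.

Lemma inv_dist_ge0 x y : 0 <= inv_dist x y. Proof. exact: powR_ge0. Qed.

Lemma inv_dist2 x y : inv_dist x y ^+ 2 = (dist2 x y)^-1.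
Proof.
by rewrite -powR_mulrn ?powR_ge0// -powRrM mulNr mulVf// powR_inv1 ?dist2_ge0.
Qed.

Lemma inv_dist_le x y : half_space x -> inv_dist x y <= (height x)^-1.
Proof.
move=> hx; apply: le_of_sqr; first by rewrite invr_ge0 ltW.
rewrite inv_dist2 exprVn lef_pV2 ?posrE ?exprn_gt0 ?dist2_gt0//.
exact: height_le_dist2.
Qed.

(** Coordinates of the unit vector from [x] to the boundary point [y]. *)
Definition direction i x y : R := offset i x y * inv_dist x y.

Lemma norm_direction i x y : half_space x -> `|direction i x y| <= 1.
Proof.
move=> hx; apply: le_of_sqr => //; rewrite expr1n -normrX ger0_norm ?sqr_ge0//.
by rewrite exprMn inv_dist2 ler_pdivrMr ?dist2_gt0// mul1r offset_le_dist2.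
Qed.

Lemma sum_direction2 x y : half_space x -> \sum_i direction i x y ^+ 2 = 1.
Proof.
move=> hx; under eq_bigr do rewrite exprMn inv_dist2.
by rewrite -mulr_suml mulfV// gt_eqF ?dist2_gt0.
Qed.

Lemma direction_max x y : direction ord_max x y = - (height x * inv_dist x y).
Proof. by rewrite /direction offset_max mulNr. Qed.

(** In each coordinate, (s + t)^2 <= 2 s^2 + 2 t^2. *)
Lemma dist2_comparison x x0 y :
  dist2 x0 y <= 2 * dist2 x y + 2 * \sum_i (x ord0 i - x0 ord0 i) ^+ 2.
Proof.
rewrite !mulr_sumr -big_split/=; apply: ler_sum => i _; rewrite /offset.
set a := nth 0 _ _; rewrite -subr_ge0.
rewrite (_ : _ - _ = (a - 2 * x ord0 i + x0 ord0 i) ^+ 2) ?sqr_ge0//.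
ring.
Qed.

Lemma inv_dist_comparison x x0 y (k : R) : half_space x -> half_space x0 -> 0 <= k ->
  dist2 x0 y <= k ^+ 2 * dist2 x y -> inv_dist x y <= k * inv_dist x0 y.
Proof.
move=> hx hx0 k0 H.
apply: le_of_sqr; first by rewrite mulr_ge0 ?inv_dist_ge0.
by rewrite exprMn !inv_dist2 ler_pdivlMr ?dist2_gt0// ler_pdivrMl ?dist2_gt0// mulrC.
Qed.

(** A neighbourhood of [x0] in the half-space on which distances to boundary points
    are at least half those from [x0], uniformly in the boundary point. *)
Definition near_point x0 x : Prop :=
  height x0 / 2 <= height x /\ \sum_i (x ord0 i - x0 ord0 i) ^+ 2 <= (height x0 / 2) ^+ 2.

Lemma near_point_half x0 x : half_space x0 -> near_point x0 x -> half_space x.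
Proof. by move=> h0 [hx _]; apply: lt_le_trans hx; rewrite divr_gt0. Qed.

Lemma near_point_refl x : half_space x -> near_point x x.
Proof.
move=> hx; split; first by rewrite ler_pdivrMr// ler_pMr// ler1n.
by rewrite big1 ?sqr_ge0// => i _; rewrite subrr expr0n.
Qed.

Lemma near_point_inv_dist x0 x y : half_space x0 -> near_point x0 x ->
  inv_dist x y <= 2 * inv_dist x0 y.
Proof.
move=> h0 nx; have hx := near_point_half h0 nx.
apply: inv_dist_comparison => //; have [_ dx] := nx.
have := dist2_comparison x x0 y; have := height_le_dist2 x0 y.
move: dx; rewrite expr_div_n; set s := \sum_i _; lra.
Qed.

(** Any two points of the half-space define the same class of integrable data. The
    factor depends on both points, unlike in [near_point_inv_dist]. *)
Lemma inv_dist_comparable x x0 : half_space x -> half_space x0 ->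
  exists2 k, 0 <= k & forall y, inv_dist x y <= k * inv_dist x0 y.
Proof.
move=> hx hx0; pose s := \sum_i (x ord0 i - x0 ord0 i) ^+ 2.
have s0 : 0 <= s by apply: sumr_ge0 => i _; exact: sqr_ge0.
have h2 : 0 < height x ^+ 2 by rewrite exprn_gt0.
have k0 : 0 <= 2 + 2 * s / height x ^+ 2 by rewrite addr_ge0// divr_ge0 ?mulr_ge0// ltW.
exists (Num.sqrt (2 + 2 * s / height x ^+ 2)); first exact: sqrtr_ge0.
move=> y; apply: inv_dist_comparison => //; rewrite ?sqrtr_ge0// sqr_sqrtr//.
apply: le_trans (dist2_comparison x x0 y) _; rewrite -/s [leRHS]mulrDl lerD2l.
by rewrite mulrAC ler_pdivlMr// ler_wpM2l ?mulr_ge0// height_le_dist2.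
Qed.

Lemma is_derive_coord x i j :
  is_derive x (e_ i) (fun z : point => z ord0 j) (j == i)%:R.
Proof.
rewrite -{1}[x]add0r -(scale0r (e_ i)); apply/is_derive_lineP.
rewrite (_ : (fun _ => _) = (cst (x ord0 j) + ((j == i)%:R \*: id))); last first.
  apply/funext => s; rewrite !mxE eqxx/= addrC; congr (_ + _).
  by rewrite mulrC.
by apply: is_derive_eq; rewrite add0r [_%:A]mulr1.
Qed.

Lemma is_derive_height x i : is_derive x (e_ i) (@height R m) (i == ord_max)%:R.
Proof. by rewrite eq_sym; exact: is_derive_coord. Qed.

Lemma is_derive_offset x y i j :
  is_derive x (e_ i) (offset j ^~ y) (- (j == i)%:R).
Proof.
rewrite (_ : (fun _ => _) = cst (nth 0 y j) - (fun z : point => z ord0 j))//.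
have := is_derive_coord x i j => ?.
by apply: is_derive_eq; rewrite sub0r.
Qed.

Lemma is_derive_dist2 x y i :
  is_derive x (e_ i) (dist2 ^~ y) (- (2 * offset i x y)).
Proof.
have D j := is_derive_offset x y i j.
rewrite (_ : (fun _ => _) = \sum_j (offset j ^~ y) ^+ 2); last first.
  by apply/funext => z; rewrite fct_sumE.
apply: is_derive_eq.
rewrite (bigD1 i)//= big1 ?addr0; last first.
  by move=> j ji; rewrite (negbTE ji) oppr0 scaler0.
rewrite eqxx expr1 [_ *: _]mulrN mulr1 //.
Qed.

Lemma is_derive_inv_dist x y i : half_space x ->
  is_derive x (e_ i) (inv_dist ^~ y) (direction i x y * inv_dist x y ^+ 2).
Proof.
move=> hx; rewrite (_ : (fun _ => _) = (@powR R ^~ (- 2^-1)) \o (dist2 ^~ y))//.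
apply: is_derive_eq.
  apply: is_derive_comp1; first by apply: is_derive1_powR; exact: dist2_gt0.
  exact: is_derive_dist2.
rewrite powRB; last by rewrite (lt0r_neq0 (dist2_gt0 y hx)) implybT.
rewrite -/(inv_dist x y) powRr1 ?dist2_ge0// -inv_dist2 /direction; by field.
Qed.

Lemma is_derive_direction x y i j : half_space x ->
  is_derive x (e_ i) (direction j ^~ y)
    ((direction i x y * direction j x y - (j == i)%:R) * inv_dist x y).
Proof.
move=> hx; have D1 := is_derive_offset x y i j; have D2 := is_derive_inv_dist y i hx.
rewrite (_ : (fun _ => _) = (offset j ^~ y) * (inv_dist ^~ y))//.
apply: is_derive_eq; rewrite /GRing.scale/= /direction; ring.
Qed.

End Kernel.

(** * Differentiation of integrals with dominated kernels *)

(** Dominated convergence is a statement about sequences; this makes it applicable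
    to integrals that depend on a point of R^n. *)
Lemma cvg_seq_at (R : realType) (V : normedModType R) (g : V -> R) (x0 : V) :
  (forall u : nat -> V, u n @[n --> \oo] --> x0 -> g (u n) @[n --> \oo] --> g x0) ->
  {for x0, continuous g}.
Proof.
move=> H; apply/cvgrPdist_lt => e e0; apply: contrapT => nH.
have K (n : nat) : exists x, `|x0 - x| < n.+1%:R^-1 /\ e <= `|g x0 - g x|.
  apply: contrapT => nK; apply: nH.
  apply/nbhs_ballP; exists n.+1%:R^-1 => /=; first by rewrite invr_gt0.
  move=> x; rewrite -ball_normE/= => xn; rewrite ltNge; apply/negP => ex.
  by apply: nK; exists x.
(* a sequence that tends to x0 while g stays at distance e from g x0 *)
pose u n := sval (cid (K n)).
have uP n : `|x0 - u n| < n.+1%:R^-1 /\ e <= `|g x0 - g (u n)|.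
  by rewrite /u; case: cid.
have : u n @[n --> \oo] --> x0.
  apply/cvgrPdist_lt => r r0; near=> n.
  have [un _] := uP n; apply: lt_trans un _.
  by near: n; exact: near_infty_natSinv_lt (PosNum r0).
move=> /H/cvgrPdist_lt/(_ _ e0)[n _ /(_ _ (leqnn n))/=].
by have [_ /le_lt_trans/[apply]] := uP n; rewrite ltxx.
Unshelve. all: by end_near. Qed.

Lemma continuous_sum_at (R : realType) (T : topologicalType) n (F : 'I_n -> T -> R) x :
  (forall i, {for x, continuous (F i)}) -> {for x, continuous (fun z => \sum_i F i z)}.
Proof.
elim: n F => [|n IH] F cF.
  rewrite (_ : (fun z => _) = cst 0); first exact: cst_continuous.
  by apply/funext => z; rewrite big_ord0.
rewrite (_ : (fun z => _) = F ord0 + (fun z => \sum_i F (lift ord0 i) z)).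
  by apply: continuousD => //; exact: IH.
by apply/funext => z; rewrite big_ord_recl.
Qed.

Section TameKernels.
Variables (R : realType) (m : nat).
Local Notation RM := (measurableTypeR R).
Local Notation point := ('rV[R]_m.+1).
Local Notation boundary := (m.-tuple RM).
Local Notation tlambda := (lebesgue_tuple R m).
Local Notation e_ i := (@basis_vector R m i).
Implicit Types (x z : point) (y : boundary) (i j : 'I_m.+1) (k : point -> boundary -> R).

(** The decay at infinity of the Poisson kernel and of all its derivatives. *)
Definition weight x y : R := inv_dist x y ^+ m.+1.

Lemma weight_ge0 x y : 0 <= weight x y.
Proof. by rewrite exprn_ge0// inv_dist_ge0. Qed.

Lemma measurable_offset i x : measurable_fun [set: boundary] (offset i x).
Proof.
apply: measurable_funB => //.
have [im|mi] := ltnP i m.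
  rewrite (_ : (fun _ => _) = (fun y : boundary => tnth y (Ordinal im))).
    exact: measurable_tnth.
  by apply/funext => y; rewrite (tnth_nth 0).
rewrite (_ : (fun _ => _) = cst 0)//.
by apply/funext => y; rewrite nth_default// size_tuple.
Qed.

Lemma measurable_dist2 x : measurable_fun [set: boundary] (dist2 x).
Proof. by apply: measurable_sum => i; apply: measurable_funX; exact: measurable_offset. Qed.

Lemma measurable_inv_dist x : measurable_fun [set: boundary] (inv_dist x).
Proof. exact: (measurableT_comp (measurable_powR _) (@measurable_dist2 x)). Qed.

Lemma measurable_weight x : measurable_fun [set: boundary] (weight x).
Proof. by apply: measurable_funX; exact: measurable_inv_dist. Qed.

Lemma measurable_direction i x : measurable_fun [set: boundary] (direction i x).
Proof.
by apply: measurable_funM; [exact: measurable_offset|exact: measurable_inv_dist].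
Qed.

(** The domination is uniform for [x] near [x0], as needed for continuity and
    differentiation under the integral sign. *)
Definition locally_dominated (w : point -> boundary -> R) k : Prop :=
  [/\ forall x, half_space x -> measurable_fun [set: boundary] (k x),
    forall x y, half_space x -> {for x, continuous (k ^~ y)} &
    forall x0, half_space x0 -> exists2 M, 0 <= M &
      forall x y, near_point x0 x -> `|k x y| <= M * w x0 y].

Definition tame := locally_dominated weight.

Definition tame_factor := locally_dominated (fun _ _ => 1).

Lemma locally_dominatedM w a k : tame_factor a -> locally_dominated w k ->
  locally_dominated w (fun x y => a x y * k x y).
Proof.
move=> [ma ca ba] [mk ck bk]; split.
- by move=> x hx; apply: measurable_funM; [exact: ma|exact: mk].
- by move=> x y hx; exact: (cvgM (ca x y hx) (ck x y hx)).
- move=> x0 h0; have [M M0 aM] := ba _ h0; have [M' M'0 kM'] := bk _ h0.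
  exists (M * M'); first exact: mulr_ge0.
  move=> x y nx; rewrite normrM -mulrA ler_pM// ?kM'//.
  by have := aM x y nx; rewrite mulr1.
Qed.

Lemma locally_dominatedB w k k' : locally_dominated w k -> locally_dominated w k' ->
  locally_dominated w (fun x y => k x y - k' x y).
Proof.
move=> [mk ck bk] [mk' ck' bk']; split.
- by move=> x hx; apply: measurable_funB; [exact: mk|exact: mk'].
- by move=> x y hx; exact: (cvgB (ck x y hx) (ck' x y hx)).
- move=> x0 h0; have [M M0 kM] := bk _ h0; have [M' M'0 kM'] := bk' _ h0.
  exists (M + M'); first exact: addr_ge0.
  by move=> x y nx; rewrite (le_trans (ler_normB _ _))// mulrDl lerD// ?kM// kM'.
Qed.

Lemma tame_factor_cst (c : R) : tame_factor (fun _ _ => c).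
Proof.
split; [by move=> x _; exact: measurable_cst|by move=> x y _; exact: cst_continuous|].
by move=> x0 _; exists `|c| => // x y _; rewrite mulr1.
Qed.

Lemma continuous_offset i x y : {for x, continuous (offset i ^~ y)}.
Proof.
have -> : offset i ^~ y = cst (nth 0 y i) - (fun z : point => z ord0 i) by [].
by apply: continuousB; [exact: cst_continuous|exact: coord_continuous].
Qed.

Lemma continuous_dist2 x y : {for x, continuous ((@dist2 R m)^~ y)}.
Proof.
apply: continuous_sum_at => i; have ci := @continuous_offset i x y.
exact: (continuousM ci ci).
Qed.

Lemma continuous_inv_dist x y : half_space x -> {for x, continuous ((@inv_dist R m)^~ y)}.
Proof.
move=> hx; have -> : (@inv_dist R m)^~ y = (fun z => (Num.sqrt (dist2 z y))^-1).
  by apply/funext => z; rewrite /inv_dist powRN powR12_sqrt ?dist2_ge0.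
apply: (@continuous_comp _ _ _ (fun z => Num.sqrt (dist2 z y)) (@GRing.inv R)); last first.
  by apply: inv_continuous; rewrite gt_eqF// sqrtr_gt0 dist2_gt0.
apply: (@continuous_comp _ _ _ ((@dist2 R m)^~ y) Num.sqrt); first exact: continuous_dist2.
exact: sqrt_continuous.
Qed.

Lemma tame_factor_inv_dist : tame_factor (@inv_dist R m).
Proof.
split; [by move=> x _; exact: measurable_inv_dist|exact: continuous_inv_dist|].
move=> x0 h0; exists (2 / height x0); first by rewrite divr_ge0// ltW.
move=> x y nx; rewrite mulr1 ger0_norm ?inv_dist_ge0//.
by rewrite (le_trans (near_point_inv_dist _ h0 nx))// ler_wpM2l// inv_dist_le.
Qed.

Lemma tame_factor_direction i : tame_factor (@direction R m i).
Proof.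
split; first by move=> x _; exact: measurable_direction.
  move=> x y hx.
  exact: (continuousM (@continuous_offset i x y) (@continuous_inv_dist x y hx)).
move=> x0 h0; exists 1 => // x y nx.
by rewrite mulr1 norm_direction//; exact: near_point_half nx.
Qed.

Lemma tame_weight : tame weight.
Proof.
split; first by move=> x _; exact: measurable_weight.
  move=> x y hx; rewrite /weight.
  exact: (@continuous_comp _ _ _ ((@inv_dist R m)^~ y) (fun t : R => t ^+ m.+1)
    x (@continuous_inv_dist x y hx) (@exprn_continuous _ _ _)).
move=> x0 h0; exists (2 ^+ m.+1); first exact: exprn_ge0.
move=> x y nx; rewrite ger0_norm ?weight_ge0// /weight -exprMn.
rewrite lerXn2r ?nnegrE ?mulr_ge0 ?inv_dist_ge0//.
exact: near_point_inv_dist.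
Qed.

(** The boundary data whose potentials converge at all points of the half-space. *)
Definition admissible (f : boundary -> R) : Prop :=
  measurable_fun [set: boundary] f /\
  forall x, half_space x ->
    tlambda.-integrable [set: boundary] (EFin \o (fun y => weight x y * f y)).

Lemma tame_integrable k f x0 x : tame k -> admissible f -> half_space x0 -> near_point x0 x ->
  tlambda.-integrable [set: boundary] (EFin \o (fun y => k x y * f y)).
Proof.
move=> [mk _ bk] [mf intf] h0 nx; have [M M0 kM] := bk _ h0.
have hx := near_point_half h0 nx.
apply: (@le_integrable _ _ _ _ _ measurableT _ (fun y => (M * (weight x0 y * f y))%:E)).
- by apply/measurable_EFinP; apply: measurable_funM => //; exact: mk.
- move=> y _ /=; rewrite lee_fin mulrA [leRHS]normrM [leLHS]normrM ler_wpM2r//.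
  by rewrite (le_trans (kM x y nx))// ler_norm.
- exact: (integrableZl measurableT M (intf _ h0)).
Qed.

Lemma near_point_near x0 : half_space x0 -> \forall x \near x0, near_point x0 x.
Proof.
move=> h0; near=> x; split.
  apply: ltW; near: x.
  have ch : {for x0, continuous (@height R m)} by exact: coord_continuous.
  by apply: (cvgr_gt _ ch); rewrite ltr_pdivrMr// ltr_pMr// ltr1n.
apply: ltW; near: x.
have cs : {for x0, continuous (fun x : point => \sum_i (x ord0 i - x0 ord0 i) ^+ 2)}.
  apply: continuous_sum_at => i.
  have ci : {for x0, continuous (fun x : point => x ord0 i - x0 ord0 i)}.
    by apply: continuousB; [exact: coord_continuous|exact: cst_continuous].
  exact: (continuousM ci ci).
apply: (cvgr_lt _ cs); rewrite big1 ?exprn_gt0 ?divr_gt0// => i _.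
by rewrite subrr expr0n.
Unshelve. all: by end_near. Qed.

Lemma half_space_near x0 : half_space x0 -> \forall x \near x0, half_space x.
Proof.
move=> h0; apply: filterS (near_point_near h0) => x; exact: near_point_half.
Qed.

Lemma continuous_tame_integral k f x0 : tame k -> admissible f -> half_space x0 ->
  {for x0, continuous (fun x => \int[tlambda]_y (k x y * f y))}.
Proof.
move=> tk af h0; have [mf intf] := af; have [mk ck bk] := tk.
have [M M0 kM] := bk _ h0.
apply: cvg_seq_at => u ux0.
have [N _ uN] : \forall n \near \oo, near_point x0 (u n).
  by apply: ux0; exact: near_point_near.
rewrite -(cvg_shiftn N); apply: fine_cvg; rewrite fineK; last first.
  apply: integrable_fin_num => //.
  exact: tame_integrable tk af h0 (near_point_refl h0).
have nu n : near_point x0 (u (n + N)%N) by apply: uN => /=; exact: leq_addl.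
apply: (@dominated_cvg _ _ _ tlambda [set: boundary] measurableT
  (fun n y => (k (u (n + N)%N) y * f y)%:E) _
  (fun y => (M * `|weight x0 y * f y|)%:E)).
- move=> n; apply/measurable_EFinP; apply: measurable_funM => //.
  by apply: mk; exact: near_point_half (nu n).
- move=> y _; apply: cvg_EFin; first exact: nearW.
  apply: cvgM; last exact: cvg_cst.
  rewrite (cvg_shiftn N (fun n => k (u n) y)).
  exact: (cvg_comp _ _ ux0 (ck x0 y h0)).
- by [].
- exact: (integrableZl measurableT M (integrable_norm (intf _ h0))).
- move=> n y _; rewrite /= lee_fin !normrM mulrA ler_wpM2r//.
  by rewrite [`|weight _ _|]ger0_norm ?weight_ge0// kM.
Qed.

(** Restrict to the line through [x] in the direction [i]. For |s| < height x / 2 the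
    points x + s e_i satisfy [near_point x], so that a single integrable function
    dominates the derivatives on this interval. *)
Lemma is_derive_tame_integral k k' f x i : tame k -> tame k' -> admissible f ->
  half_space x ->
  (forall z y, half_space z -> is_derive z (e_ i) (k ^~ y) (k' z y)) ->
  is_derive x (e_ i) (fun z => \int[tlambda]_y (k z y * f y)) (\int[tlambda]_y (k' x y * f y)).
Proof.
move=> tk tk' af hx dk; have [mf intf] := af; have [mk' _ bk'] := tk'.
have [M M0 kM] := bk' _ hx.
pose F (s : R) (y : boundary) : R := k (s *: e_ i + x) y * f y.
pose G (y : boundary) : R := M * `|weight x y * f y|.
have h2 : 0 < height x / 2 by rewrite divr_gt0.
have nI (s : R) : s \in `](- (height x / 2)), (height x / 2)[ -> near_point x (s *: e_ i + x).
  rewrite in_itv/= => /andP[s1 s2]; split.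
    rewrite /height !mxE eqxx/= -/(height x).
    by case: (_ == _); rewrite ?mulr1 ?mulr0; lra.
  rewrite (bigD1 i)//= big1 ?addr0.
    by rewrite !mxE !eqxx/= mulr1 addrK -subr_ge0 subr_sqr mulr_ge0//; lra.
  by move=> j ji; rewrite !mxE eqxx/= (negbTE ji) mulr0 add0r subrr expr0n.
have dF s y : s \in `](- (height x / 2)), (height x / 2)[ ->
    is_derive s 1 (F ^~ y) (k' (s *: e_ i + x) y * f y).
  move=> sI; have := dk _ y (near_point_half hx (nI _ sI)).
  move=> /is_derive_lineP dks.
  rewrite (_ : F ^~ y = (fun s : R => k (s *: e_ i + x) y) * cst (f y))//.
  apply: is_derive_eq; rewrite scaler0 add0r /GRing.scale/= mulrC//.
have I0 : `](- (height x / 2)), (height x / 2)[%classic 0.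
  by rewrite /= in_itv/= h2 oppr_lt0 h2.
have intF s : `](- (height x / 2)), (height x / 2)[%classic s ->
    tlambda.-integrable [set: boundary] (EFin \o F s).
  by move=> sI; exact: tame_integrable tk af hx (nI _ sI).
have derF s y : `](- (height x / 2)), (height x / 2)[%classic s -> [set: boundary] y ->
    derivable (F ^~ y) s 1.
  by move=> sI _; have [] := dF s y sI.
have G0 y : 0 <= G y by rewrite mulr_ge0.
have intG : tlambda.-integrable [set: boundary] (EFin \o G).
  exact: (integrableZl measurableT M (integrable_norm (intf _ hx))).
have GF s y : `](- (height x / 2)), (height x / 2)[%classic s -> [set: boundary] y ->
    `|partial1of2 F s y| <= G y.
  move=> sI _; have Fs := dF s y sI; rewrite partial1of2E derive_val /G !normrM mulrA.
  rewrite ler_wpM2r// [`|weight _ _|]ger0_norm ?weight_ge0//.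
  by rewrite kM//; exact: nI.
rewrite -{1}[x]add0r -(scale0r (e_ i)); apply/is_derive_lineP.
apply: DeriveDef.
  exact: (derivable_under_integral measurableT I0 intF derF G0 intG GF).
rewrite -derive1E (differentiation_under_integral measurableT I0 intF derF G0 intG GF).
apply: eq_Rintegral => y _; rewrite partial1of2E.
by have F0 := dF 0 y I0; rewrite derive_val scale0r add0r.
Qed.

End TameKernels.

(** * Harmonicity of Poisson integrals *)

Lemma Rintegral_sum d (T : measurableType d) (R : realType) (mu : {measure set T -> \bar R})
    N (F : 'I_N -> T -> R) :
  (forall i, mu.-integrable [set: T] (EFin \o F i)) ->
  \int[mu]_y (\sum_i F i y) = \sum_i \int[mu]_y F i y.
Proof.
move=> iF; rewrite /Rintegral sum_fine; last first.
  by move=> i _; exact: integrable_fin_num (iF i).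
congr fine; rewrite -integral_sum//.
by apply: eq_integral => y _; rewrite sumEFin.
Qed.

Section PoissonIntegral.
Variables (R : realType) (m : nat).
Local Notation RM := (measurableTypeR R).
Local Notation point := ('rV[R]_m.+1).
Local Notation boundary := (m.-tuple RM).
Local Notation tlambda := (lebesgue_tuple R m).
Local Notation e_ i := (@basis_vector R m i).
Local Notation n := (m.+1).
Implicit Types (x z : point) (y : boundary) (i j : 'I_m.+1) (f : boundary -> R).

(** The partial derivatives of [weight], written as a bounded kernel times [weight];
    [kernel2] is the same for the second derivatives. *)
Definition kernel1 i x y : R := n%:R * (direction i x y * inv_dist x y) * weight x y.

Definition kernel2 i j x y : R :=
  n%:R * (((n%:R + 2) * (direction i x y * direction j x y) - (i == j)%:R)
    * (inv_dist x y * inv_dist x y)) * weight x y.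

Lemma tame_kernel1 i : tame (kernel1 i).
Proof.
apply: locally_dominatedM; last exact: tame_weight.
apply: locally_dominatedM; first exact: tame_factor_cst.
by apply: locally_dominatedM; [exact: tame_factor_direction|exact: tame_factor_inv_dist].
Qed.

Lemma tame_kernel2 i j : tame (kernel2 i j).
Proof.
apply: locally_dominatedM; last exact: tame_weight.
apply: locally_dominatedM; first exact: tame_factor_cst.
apply: locally_dominatedM; last by apply: locally_dominatedM; exact: tame_factor_inv_dist.
apply: locally_dominatedB; last exact: tame_factor_cst.
apply: locally_dominatedM; first exact: tame_factor_cst.
by apply: locally_dominatedM; exact: tame_factor_direction.
Qed.

Lemma is_derive_weight x y i : half_space x ->
  is_derive x (e_ i) ((@weight R m)^~ y) (kernel1 i x y).
Proof.
move=> hx; have D := is_derive_inv_dist y i hx.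
rewrite (_ : _^~ y = ((@inv_dist R m)^~ y) ^+ n); last first.
  by apply/funext => z; rewrite fctE.
apply: is_derive_eq; rewrite /GRing.scale/= /kernel1 /weight [inv_dist x y ^+ n]exprS.
ring.
Qed.

Lemma is_derive_kernel1 x y i j : half_space x ->
  is_derive x (e_ j) ((kernel1 i)^~ y) (kernel2 i j x y).
Proof.
move=> hx; have D1 := is_derive_inv_dist y j hx.
have D2 := is_derive_weight y j hx.
have D3 := is_derive_direction y j i hx.
rewrite (_ : _^~ y = (cst n%:R * (((@direction R m i)^~ y) * ((@inv_dist R m)^~ y)))
  * ((@weight R m)^~ y)) //.
apply: is_derive_eq; rewrite /GRing.scale/= !fctE/= /kernel1 /kernel2; ring.
Qed.

Definition potential f x : R := \int[tlambda]_y (weight x y * f y).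
Definition potential1 i f x : R := \int[tlambda]_y (kernel1 i x y * f y).
Definition potential2 i j f x : R := \int[tlambda]_y (kernel2 i j x y * f y).

Lemma is_derive_potential f x i : admissible f -> half_space x ->
  is_derive x (e_ i) (potential f) (potential1 i f x).
Proof.
move=> af hx; apply: is_derive_tame_integral => //.
- exact: tame_weight.
- exact: tame_kernel1.
- by move=> z y hz; exact: is_derive_weight.
Qed.

Lemma is_derive_potential1 f x i j : admissible f -> half_space x ->
  is_derive x (e_ j) (potential1 i f) (potential2 i j f x).
Proof.
move=> af hx; apply: is_derive_tame_integral => //.
- exact: tame_kernel1.
- exact: tame_kernel2.
- by move=> z y hz; exact: is_derive_kernel1.
Qed.

Local Notation c := (2 / sphere_area R m).

Lemma poisson_integralE f x : admissible f -> half_space x ->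
  poisson_integral f x = c * (height x * potential f x).
Proof.
move=> af hx; rewrite /poisson_integral; congr (_ * _).
rewrite /potential -RintegralZl//; last first.
  exact: tame_integrable (@tame_weight R m) af hx (near_point_refl hx).
by apply: eq_Rintegral => y _; rewrite /weight inv_distE exprVn mulrA.
Qed.

Lemma biharmonic_solutionE f x : admissible f -> half_space x ->
  biharmonic_solution f x = c * (height x ^+ 2 * potential f x).
Proof.
move=> af hx; rewrite /biharmonic_solution; congr (_ * _).
rewrite /potential -RintegralZl//; last first.
  exact: tame_integrable (@tame_weight R m) af hx (near_point_refl hx).
by apply: eq_Rintegral => y _; rewrite /weight inv_distE exprVn mulrA.
Qed.

(** The Laplacian in x of h r^(-n). As the squares of the directions sum to 1, the
    trace of [kernel2] is 2 n r^(-2 - n); the first term is the opposite of h times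
    this trace, because the normal direction is - h / r. *)
Lemma laplacian_kernel x y : half_space x ->
  2 * kernel1 ord_max x y + height x * \sum_i kernel2 i i x y = 0.
Proof.
move=> hx; rewrite /kernel1 /kernel2 -mulr_suml -mulr_sumr -mulr_suml.
rewrite sumrB -mulr_sumr.
under eq_bigr do rewrite -expr2.
rewrite sum_direction2//.
under [X in _ - X]eq_bigr do rewrite eqxx.
rewrite sumr_const card_ord direction_max -[true%:R *+ n]/(n%:R); ring.
Qed.

Definition dpoisson i f x : R :=
  c * ((i == ord_max)%:R * potential f x + height x * potential1 i f x).

Definition ddpoisson i j f x : R :=
  c * ((i == ord_max)%:R * potential1 j f x
       + ((j == ord_max)%:R * potential1 i f x + height x * potential2 i j f x)).

Lemma is_derive_poisson f x i : admissible f -> half_space x ->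
  is_derive x (e_ i) (poisson_integral f) (dpoisson i f x).
Proof.
move=> af hx.
apply: (@near_eq_is_derive _ _ _ (cst c * (@height R m * potential f))).
  apply: filterS (half_space_near hx) => z hz.
  by rewrite poisson_integralE.
have D1 := is_derive_height x i; have D2 := is_derive_potential i af hx.
apply: is_derive_eq; rewrite /GRing.scale/= !fctE/= /dpoisson; ring.
Qed.

Lemma is_derive_dpoisson f x i j : admissible f -> half_space x ->
  is_derive x (e_ j) (dpoisson i f) (ddpoisson i j f x).
Proof.
move=> af hx; have D1 := is_derive_height x j; have D2 := is_derive_potential j af hx.
have D3 := is_derive_potential1 i j af hx.
rewrite (_ : dpoisson i f = cst c * ((cst (i == ord_max)%:R * potential f)
  + (@height R m * potential1 i f)))//.
apply: is_derive_eq; rewrite /GRing.scale/= !fctE/= /ddpoisson; ring.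
Qed.

Lemma continuous_ddpoisson f x i j : admissible f -> half_space x ->
  {for x, continuous (ddpoisson i j f)}.
Proof.
move=> af hx.
have c1 k : {for x, continuous (potential1 k f)}.
  exact: continuous_tame_integral (tame_kernel1 k) af hx.
have c2 : {for x, continuous (potential2 i j f)}.
  exact: continuous_tame_integral (tame_kernel2 i j) af hx.
have ch : {for x, continuous (@height R m)} by exact: coord_continuous.
have cst (a : R) : {for x, continuous (cst a : point -> R)} by exact: cst_continuous.
exact: (continuousM (cst c) (continuousD (continuousM (cst _) (c1 j))
  (continuousD (continuousM (cst _) (c1 i)) (continuousM ch c2)))).
Qed.

Lemma laplacian_poisson f x : admissible f -> half_space x -> \sum_i ddpoisson i i f x = 0.
Proof.
move=> af hx; rewrite /ddpoisson -mulr_sumr.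
have i1 : tlambda.-integrable [set: boundary] (EFin \o (fun y => kernel1 ord_max x y * f y)).
  exact: tame_integrable (tame_kernel1 _) af hx (near_point_refl hx).
have i2 i : tlambda.-integrable [set: boundary] (EFin \o (fun y => kernel2 i i x y * f y)).
  exact: tame_integrable (tame_kernel2 _ _) af hx (near_point_refl hx).
rewrite big_split big_split/= -mulr_sumr.
have -> : \sum_i (i == ord_max)%:R * potential1 i f x = potential1 ord_max f x.
  rewrite (bigD1 ord_max)//= eqxx mul1r big1 ?addr0// => i /negbTE ->.
  by rewrite mul0r.
have -> : \sum_i potential2 i i f x = \int[tlambda]_y \sum_i (kernel2 i i x y * f y).
  exact/esym/Rintegral_sum.
have is2 : tlambda.-integrable [set: boundary]
    (EFin \o (fun y => \sum_i (kernel2 i i x y * f y))).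
  rewrite (_ : _ \o _ = (fun y => \sum_i (kernel2 i i x y * f y)%:E)%E).
    by apply: integrable_sum => // i _; exact: i2.
  by apply/funext => y; rewrite /= sumEFin.
have -> : potential1 ord_max f x + (potential1 ord_max f x
    + height x * \int[tlambda]_y \sum_i (kernel2 i i x y * f y))
  = \int[tlambda]_y (2 * (kernel1 ord_max x y * f y)
    + height x * \sum_i (kernel2 i i x y * f y)).
  rewrite RintegralD//.
  - by rewrite !RintegralZl// /potential1; ring.
  - exact: (integrableZl measurableT 2 i1).
  - exact: (integrableZl measurableT (height x) is2).
rewrite (_ : (\int[tlambda]_y _) = 0) ?mulr0//.
transitivity (\int[tlambda]_y (0 : R)).
  apply: eq_Rintegral => y _; rewrite -mulr_suml (mulrA 2) (mulrA (height x)) -mulrDl.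
  by rewrite laplacian_kernel// mul0r.
by rewrite /Rintegral integral0.
Qed.

Lemma harmonic_poisson f : admissible f -> Defs.harmonic (poisson_integral f).
Proof.
move=> af x hx.
have E1 z i : half_space z -> 'D_(e_ i) (poisson_integral f) z = dpoisson i f z.
  by move=> hz; have D := is_derive_poisson i af hz; rewrite derive_val.
have N1 z i : half_space z ->
    \near z, dpoisson i f z = 'D_(e_ i) (poisson_integral f) z.
  by move=> hz; apply: filterS (half_space_near hz) => z' hz'; rewrite E1.
have D2 z i j : half_space z ->
    is_derive z (e_ j) ('D_(e_ i) (poisson_integral f)) (ddpoisson i j f z).
  move=> hz; apply: near_eq_is_derive (N1 z i hz) _.
  exact: is_derive_dpoisson.
have E2 z i j : half_space z ->
    'D_(e_ j) ('D_(e_ i) (poisson_integral f)) z = ddpoisson i j f z.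
  by move=> hz; have D := D2 z i j hz; rewrite derive_val.
split=> [i j|]; last first.
  by under eq_bigr do rewrite E2//; exact: laplacian_poisson.
split.
- by have [] := is_derive_poisson i af hx.
- by have [] := D2 x i j hx.
- have H : {near x, ddpoisson i j f =1 'D_(e_ j) ('D_(e_ i) (poisson_integral f))}.
    by apply: filterS (half_space_near hx) => z hz; rewrite E2.
  have := cvg_trans (near_eq_cvg H) (@continuous_ddpoisson f x i j af hx).
  rewrite -(E2 x i j hx) => K; exact: K.
Qed.

End PoissonIntegral.

(** * Weighted integrals of functions in L^p *)

Section LpBoundary.
Variables (R : realType) (m : nat).
Local Notation RM := (measurableTypeR R).
Local Notation point := ('rV[R]_m.+1).
Local Notation boundary := (m.-tuple RM).
Local Notation tlambda := (lebesgue_tuple R m).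
Local Notation n := (m.+1).
Implicit Types (x z : point) (y : boundary) (i j : 'I_m.+1) (f g : boundary -> R) (p : \bar R).

(** The point (0, ..., 0, 1), the only one at which constants are computed. *)
Definition apex : point := @basis_vector R m ord_max.

Lemma height_apex : height apex = 1.
Proof. by rewrite /height mxE !eqxx. Qed.

Lemma half_space_apex : half_space apex.
Proof. by rewrite /half_space/= height_apex ltr01. Qed.

Lemma dist2_apex y : dist2 apex y = 1 + sqnorm y.
Proof.
rewrite /dist2 big_ord_recr/= offset_max height_apex sqrrN expr1n addrC; congr (_ + _).
apply: eq_bigr => i _; rewrite /offset !mxE eqxx/= (tnth_nth 0).
by rewrite (_ : _ == _ = false) ?subr0// -val_eqE/= ltn_eqF.
Qed.

Lemma inv_dist_apex_le1 y : inv_dist apex y <= 1.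
Proof. by rewrite (le_trans (inv_dist_le _ half_space_apex))// height_apex invr1. Qed.

Lemma weight_apex_le1 y : weight apex y <= 1.
Proof. by rewrite exprn_ile1 ?inv_dist_ge0 ?inv_dist_apex_le1. Qed.

Lemma sphere_area_gt0 : 0 < sphere_area R m.
Proof. by have [] := poisson_normalization R m. Qed.

Lemma integral_weight_apex :
  (\int[tlambda]_y (weight apex y)%:E = (sphere_area R m / 2)%:E)%E.
Proof.
have [_ <-] := poisson_normalization R m; apply: eq_integral => y _.
rewrite -dist2_apex /weight -powR_mulrn ?inv_dist_ge0// /inv_dist -powRrM.
by congr (_ `^ _)%:E; ring.
Qed.

Lemma LpE p f : Lp p f <->
  measurable_fun [set: boundary] f /\ (Lnorm tlambda p (EFin \o f) < +oo)%E.
Proof.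
rewrite /Lp/=; split.
  move=> fL; split; first by have := sub_Lfun_mfun fL; rewrite inE.
  by have := sub_Lfun_finLfun fL; rewrite inE.
by move=> [mf foo]; rewrite inE; apply/andP; rewrite !inE.
Qed.

Lemma Lp_normE p f : Lp p f -> Lnorm tlambda p (EFin \o f) = (Lp_norm p f)%:E.
Proof.
move=> /LpE[_ foo]; rewrite /Lp_norm fineK// ge0_fin_numE//; exact: Lnorm_ge0.
Qed.

Lemma Lp_norm_ge0 p f : 0 <= Lp_norm p f.
Proof. by rewrite /Lp_norm fine_ge0// Lnorm_ge0. Qed.

Lemma lebesgue_tupleT_gt0 : (0 < tlambda [set: boundary])%E.
Proof.
have H : (tlambda (@cube R m 1) <= tlambda [set: boundary])%E.
  by apply: le_measure; rewrite ?inE//; exact: measurable_box.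
apply: lt_le_trans H.
by rewrite lebesgue_tuple_cube lte_fin exprn_gt0.
Qed.

Lemma integral_powR_norm (r : R) f : 1 <= r -> Lp r%:E f ->
  (\int[tlambda]_y (`|f y| `^ r)%:E = (Lp_norm r%:E f `^ r)%:E)%E.
Proof.
move=> r1 fL; rewrite -poweR_EFin -Lp_normE// powR_Lnorm ?gt_eqF ?(lt_le_trans _ r1)//.
Qed.

(** If N = |f|_p > 0 then |f| <= N (1 + (|f| / N)^p); integrate this against [weight],
    which is at most 1 at the apex. Using N + d instead of N and letting d tend to 0
    includes the case N = 0. For p = oo, |f| <= N almost everywhere. *)
Lemma weighted_L1_bound p f : (1 <= p)%E -> Lp p f ->
  (\int[tlambda]_y (weight apex y * `|f y|)%:E
   <= ((sphere_area R m / 2 + 1) * Lp_norm p f)%:E)%E.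
Proof.
have I0 : 0 <= sphere_area R m / 2 by rewrite divr_ge0// ltW// sphere_area_gt0.
have mw : measurable_fun [set: boundary] (weight apex) by exact: measurable_weight.
move=> p1 fL; have /LpE[mf foo] := fL.
have mwf : measurable_fun [set: boundary] (fun y => weight apex y * `|f y|).
  by apply: measurable_funM => //; exact: measurableT_comp.
have wf0 y : 0 <= weight apex y * `|f y| by rewrite mulr_ge0// weight_ge0.
case: p p1 fL foo => [r| |]//; last first.
  move=> _ fL _; apply: (@le_trans _ _ (\int[tlambda]_y ((Lp_norm +oo%E f)%:E * (weight apex y)%:E))%E).
    apply: ae_ge0_le_integral => //.
    - by move=> y _; rewrite lee_fin.
    - exact/measurable_EFinP.
    - by move=> y _; rewrite mule_ge0// lee_fin ?Lp_norm_ge0 ?weight_ge0.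
    - by apply: measurable_funeM; exact/measurable_EFinP.
    - have := ess_sup_ge tlambda (abse \o (EFin \o f)).
      have := Lp_normE fL; rewrite unlock lebesgue_tupleT_gt0 => ->.
      apply: filterS => y /=; rewrite lee_fin => fy _.
      by rewrite -EFinM lee_fin mulrC ler_wpM2r ?weight_ge0.
  rewrite ge0_integralZl//; last 3 first.
  - exact/measurable_EFinP.
  - by move=> y _; rewrite lee_fin weight_ge0.
  - by rewrite lee_fin Lp_norm_ge0.
  rewrite integral_weight_apex -EFinM lee_fin mulrC ler_wpM2r ?Lp_norm_ge0//.
  by rewrite lerDl.
rewrite lee_fin => r1 fL _.
have r0 : 0 < r by exact: lt_le_trans r1.
have N0 := Lp_norm_ge0 r%:E f; set N := Lp_norm _ f in N0 *.
apply/lee_addgt0Pr => e e0.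
(* d is chosen so that the bound for N + d exceeds the bound for N by e *)
pose d := e / (sphere_area R m / 2 + 1).
have I1 : 0 < sphere_area R m / 2 + 1 by rewrite ltr_wpDl.
have d0 : 0 < d by rewrite divr_gt0.
rewrite -EFinD (_ : _ * N + e = (sphere_area R m / 2 + 1) * (N + d)); last first.
  by rewrite mulrDr; congr (_ + _); rewrite /d mulrC divfK// gt_eqF.
have N'0 : 0 < N + d by rewrite ltr_wpDl.
apply: (@le_trans _ _ (\int[tlambda]_y ((N + d)%:E * ((weight apex y)%:E
     + ((N + d) `^ r)^-1%:E * (`|f y| `^ r)%:E)))%E).
  apply: ge0_le_integral => //.
  - by move=> y _; rewrite lee_fin.
  - exact/measurable_EFinP.
  - apply: measurable_funeM; apply: emeasurable_funD; first exact/measurable_EFinP.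
    apply: measurable_funeM; apply/measurable_EFinP.
    by apply: (measurableT_comp (measurable_powR _)); exact: measurableT_comp.
  - move=> y _; rewrite -[X in (_ * (_ + X))%E]EFinM -EFinD -EFinM lee_fin.
    have w0 : 0 <= weight apex y by exact: weight_ge0.
    have w1 := weight_apex_le1 y.
    set t := `|f y| / (N + d).
    have t0 : 0 <= t by rewrite divr_ge0// ltW.
    have -> : ((N + d) `^ r)^-1 * `|f y| `^ r = t `^ r.
      rewrite /t powRM// ?invr_ge0 ?ltW// mulrC; congr (_ * _).
      by rewrite -[(N + d)^-1]powR_inv1 ?ltW// -powRrM mulN1r powRN.
    have -> : `|f y| = (N + d) * t by rewrite /t mulrC divfK// gt_eqF.
    rewrite mulrCA ler_wpM2l ?(ltW N'0)//.
    have tr0 : 0 <= t `^ r by exact: powR_ge0.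
    have [t1|t1] := lerP t 1.
      by rewrite (@le_trans _ _ (weight apex y))// ?ler_piMr// lerDl.
    rewrite (@le_trans _ _ t)// ?ler_piMl//.
    by rewrite (le_trans (le1r_powR (ltW t1) r1))// lerDr.
rewrite ge0_integralZl//; last 3 first.
- apply: emeasurable_funD; first exact/measurable_EFinP.
  apply: measurable_funeM; apply/measurable_EFinP.
  by apply: (measurableT_comp (measurable_powR _)); exact: measurableT_comp.
- by move=> y _; rewrite adde_ge0// ?mule_ge0// lee_fin ?weight_ge0 ?powR_ge0 ?invr_ge0 ?powR_ge0.
- by rewrite lee_fin ltW.
rewrite ge0_integralD//; last 4 first.
- by move=> y _; rewrite lee_fin weight_ge0.
- exact/measurable_EFinP.
- by move=> y _; rewrite mule_ge0// lee_fin ?invr_ge0 powR_ge0.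
- apply: measurable_funeM; apply/measurable_EFinP.
  by apply: (measurableT_comp (measurable_powR _)); exact: measurableT_comp.
rewrite ge0_integralZl//; last 2 first.
- apply/measurable_EFinP.
  by apply: (measurableT_comp (measurable_powR _)); exact: measurableT_comp.
- by rewrite lee_fin invr_ge0 powR_ge0.
rewrite integral_powR_norm// integral_weight_apex -[X in (_ * (_ + X))%E]EFinM -EFinD -EFinM lee_fin.
rewrite mulrC ler_wpM2r ?(ltW N'0)// lerD2l -/N ler_pdivrMl ?powR_gt0// mulr1.
by rewrite ge0_ler_powR// ?nnegrE ?lerDl// ltW.
Qed.

End LpBoundary.

(** * Dilations of the boundary *)

Section Dilation.
Variables (R : realType) (m : nat).
Local Notation RM := (measurableTypeR R).
Local Notation point := ('rV[R]_m.+1).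
Local Notation boundary := (m.-tuple RM).
Local Notation tlambda := (lebesgue_tuple R m).
Local Notation n := (m.+1).
Implicit Types (x z : point) (y : boundary) (i j : 'I_m.+1) (f g : boundary -> R) (p : \bar R).

Lemma weighted_integrable p f : (1 <= p)%E -> Lp p f ->
  tlambda.-integrable [set: boundary] (EFin \o (fun y => weight (apex R m) y * f y)).
Proof.
move=> p1 fL; have /LpE[mf _] := fL; apply/integrableP; split.
  by apply/measurable_EFinP; apply: measurable_funM => //; exact: measurable_weight.
apply: le_lt_trans (ltry ((sphere_area R m / 2 + 1) * Lp_norm p f)).
apply: le_trans (weighted_L1_bound p1 fL).
rewrite le_eqVlt; apply/orP; left; apply/eqP; apply: eq_integral => y _.
by rewrite /= normrM ger0_norm ?weight_ge0.
Qed.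

Lemma Lp_admissible p f : (1 <= p)%E -> Lp p f -> admissible f.
Proof.
move=> p1 fL; have /LpE[mf _] := fL; split=> // x hx.
have [k k0 xk] := inv_dist_comparable hx (half_space_apex R m).
apply: (@le_integrable _ _ _ _ _ measurableT _
    (fun y => ((k ^+ n) * (weight (apex R m) y * f y))%:E)).
- by apply/measurable_EFinP; apply: measurable_funM => //; exact: measurable_weight.
- move=> y _ /=; rewrite lee_fin mulrA [leRHS]normrM [leLHS]normrM ler_wpM2r//.
  rewrite !ger0_norm ?mulr_ge0 ?exprn_ge0 ?weight_ge0 ?inv_dist_ge0//.
  by rewrite /weight -exprMn lerXn2r ?nnegrE ?mulr_ge0 ?inv_dist_ge0.
- exact: (integrableZl measurableT (k ^+ n) (weighted_integrable p1 fL)).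
Qed.

Lemma bounded_weighted_integrable p f g (B : R) : (1 <= p)%E -> Lp p f ->
  measurable_fun [set: boundary] g -> (forall y, `|g y| <= B) ->
  tlambda.-integrable [set: boundary] (EFin \o (fun y => g y * weight (apex R m) y * f y)).
Proof.
move=> p1 fL mg gB; have /LpE[mf _] := fL.
have B0 : 0 <= B by apply: le_trans (gB [tuple 0 | _ < m]).
apply: (@le_integrable _ _ _ _ _ measurableT _
  (fun y => (B * (weight (apex R m) y * f y))%:E)).
- apply/measurable_EFinP; do 2 apply: measurable_funM => //.
  exact: measurable_weight.
- move=> y _ /=; rewrite lee_fin -mulrA [leRHS]normrM [leLHS]normrM ler_wpM2r//.
  by rewrite [`|B|]ger0_norm.
- exact: (integrableZl measurableT B (weighted_integrable p1 fL)).
Qed.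

Lemma weighted_integral_bound p f g (B : R) : (1 <= p)%E -> Lp p f ->
  measurable_fun [set: boundary] g -> (forall y, `|g y| <= B) ->
  `|\int[tlambda]_y (g y * weight (apex R m) y * f y)|
  <= B * ((sphere_area R m / 2 + 1) * Lp_norm p f).
Proof.
move=> p1 fL mg gB; have /LpE[mf _] := fL.
have B0 : 0 <= B by apply: le_trans (gB [tuple 0 | _ < m]).
have mw : measurable_fun [set: boundary] (weight (apex R m)) by exact: measurable_weight.
have gi := bounded_weighted_integrable p1 fL mg gB.
rewrite (le_trans (le_normr_Rintegral measurableT gi))//.
rewrite -lee_fin /Rintegral fineK; last first.
  by apply: integrable_fin_num => //; exact: (integrable_norm gi).
rewrite EFinM; apply: (@le_trans _ _ (B%:E * \int[tlambda]_y (weight (apex R m) y * `|f y|)%:E)%E).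
  rewrite -ge0_integralZl//; last 2 first.
  - apply/measurable_EFinP; apply: measurable_funM => //.
    exact: measurableT_comp.
  - by move=> y _; rewrite lee_fin mulr_ge0 ?weight_ge0.
  apply: ge0_le_integral => //.
  - by apply/measurable_EFinP; apply: measurableT_comp => //; do 2 apply: measurable_funM => //.
  - apply: measurable_funeM; apply/measurable_EFinP; apply: measurable_funM => //.
    exact: measurableT_comp.
  - move=> y _; rewrite -EFinM lee_fin -mulrA !normrM [`|weight _ _|]ger0_norm ?weight_ge0//.
    by rewrite ler_wpM2r// mulr_ge0 ?weight_ge0.
rewrite lee_pmul ?lee_fin//.
  by apply: integral_ge0 => y _; rewrite lee_fin mulr_ge0 ?weight_ge0.
exact: weighted_L1_bound.
Qed.

Section Dilate.
Variables (t : R) (b : 'I_m -> R).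
Hypothesis t0 : 0 < t.

Definition dilate : boundary -> boundary := affine_perm 1%g (fun=> t) b.

Lemma measurable_dilate : measurable_fun [set: boundary] dilate.
Proof. exact: measurable_affine_perm. Qed.

Lemma lebesgue_dilate (A : set boundary) : measurable A ->
  tlambda (dilate @^-1` A) = ((t ^- m)%:E * tlambda A)%E.
Proof.
move=> mA; rewrite lebesgue_tuple_affine_perm//; last by move=> _; rewrite gt_eqF.
by rewrite prodr_const card_ord gtr0_norm// exprVn.
Qed.

Lemma ae_dilate (P : boundary -> Prop) :
  {ae tlambda, forall y, P y} -> {ae tlambda, forall y, P (dilate y)}.
Proof.
move=> [N [mN N0 PN]]; exists (dilate @^-1` N); split.
- by rewrite -[X in measurable X]setTI; exact: measurable_dilate.
- by rewrite [LHS]lebesgue_dilate// N0 mule0.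
- by move=> y /= nP; exact: PN.
Qed.

End Dilate.

Definition undilate (t : R) (b : 'I_m -> R) : boundary -> boundary :=
  dilate t^-1 (fun k : 'I_m => - (b k / t)).

Lemma undilateK t b : 0 < t -> cancel (undilate t b) (dilate t b).
Proof.
move=> t0 y; apply: eq_from_tnth => i; rewrite !tnth_mktuple !perm1.
by field; rewrite gt_eqF.
Qed.

Lemma dilateK t b : 0 < t -> cancel (dilate t b) (undilate t b).
Proof.
move=> t0 y; apply: eq_from_tnth => i; rewrite !tnth_mktuple !perm1.
by field; rewrite gt_eqF.
Qed.

(** For p = oo, bounds that hold almost everywhere are transported in both
    directions, by the dilation and by its inverse. *)
Lemma Lnorm_dilate t b p f : 0 < t -> (1 <= p)%E -> measurable_fun [set: boundary] f ->
  (Lnorm tlambda p (EFin \o (f \o dilate t b))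
   = (t `^ (- codim_over m p))%:E * Lnorm tlambda p (EFin \o f))%E.
Proof.
move=> t0 p1 mf.
have tm0 : 0 <= t ^- m by rewrite invr_ge0 exprn_ge0// ltW.
case: p p1 => [r| |]//=.
  rewrite lee_fin => r1; have r0 : 0 < r by exact: lt_le_trans r1.
  rewrite unlock.
  rewrite (ge0_integral_scaled (measurable_dilate t b) tm0 (lebesgue_dilate b t0)
    (f := fun y => (`|(EFin \o f) y| `^ r)%E)); last 2 first.
  - rewrite (_ : (fun y => _) = EFin \o (fun y => `|f y| `^ r))//.
    apply/measurable_EFinP; apply: (measurableT_comp (measurable_powR _)).
    exact: measurableT_comp.
  - by move=> y; exact: poweR_ge0.
  rewrite poweRM ?lee_fin//; last by apply: integral_ge0 => y _; exact: poweR_ge0.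
  congr (_ * _)%E; rewrite poweR_EFin; congr _%:E.
  by rewrite -powR_invn ?ltW// -powRrM mulNr.
move=> _; rewrite oppr0 powRr0 mul1e unlock lebesgue_tupleT_gt0.
apply/eqP; rewrite eq_le; apply/andP; split; apply/ess_supP.
  by apply: (ae_dilate b t0 (P := fun y => (abse \o (EFin \o f)) y <= _)%E); exact: ess_sup_ge.
have := ess_sup_ge tlambda (abse \o (EFin \o (f \o dilate t b))).
have ti0 : 0 < t^-1 by rewrite invr_gt0.
move=> /(ae_dilate (fun k : 'I_m => - (b k / t)) ti0); apply: filterS => y /=.
by rewrite undilateK.
Qed.

Lemma Lp_dilate t b p f : 0 < t -> (1 <= p)%E -> Lp p f ->
  Lp p (f \o dilate t b) /\ Lp_norm p (f \o dilate t b) = t `^ (- codim_over m p) * Lp_norm p f.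
Proof.
move=> t0 p1 fL; have /LpE[mf foo] := fL; split.
  apply/LpE; split; first exact: measurableT_comp mf (measurable_dilate t b).
  by rewrite Lnorm_dilate// Lp_normE// -EFinM ltry.
by rewrite /Lp_norm Lnorm_dilate// Lp_normE.
Qed.

End Dilation.

(** * The gradient and the sharp constant *)

Section GradientField.
Variables (R : realType) (m : nat).
Local Notation RM := (measurableTypeR R).
Local Notation point := ('rV[R]_m.+1).
Local Notation boundary := (m.-tuple RM).
Local Notation tlambda := (lebesgue_tuple R m).
Local Notation n := (m.+1).
Local Notation c := (2 / sphere_area R m).
Local Notation e_ i := (@basis_vector R m i).
Implicit Types (x z : point) (y : boundary) (i j : 'I_m.+1) (f g : boundary -> R) (p : \bar R) (b : R).

(** The density of the i-th partial derivative of c h^b Q f, without the factor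
    h^(b - 1) r^(-n). It depends on [x] and [y] only through the direction from [x]
    to [y], hence is invariant under similarities. *)
Definition gradient_density b i x y : R :=
  b * (i == ord_max)%:R - n%:R * (direction ord_max x y * direction i x y).

Definition gradient_field b f x : point :=
  \row_i (c * (height x `^ (b - 1)
    * \int[tlambda]_y (gradient_density b i x y * weight x y * f y))).

Lemma tame_factor_gradient_density b i : tame_factor (gradient_density b i).
Proof.
apply: locally_dominatedB; first exact: tame_factor_cst.
apply: locally_dominatedM; first exact: tame_factor_cst.
by apply: locally_dominatedM; exact: tame_factor_direction.
Qed.

(** Since the normal direction is - h / r, the term n d_n d_i r^(-n) is - h times
    [kernel1]. *)
Lemma integral_gradient_density b i f x : admissible f -> half_space x ->
  \int[tlambda]_y (gradient_density b i x y * weight x y * f y)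
  = b * (i == ord_max)%:R * potential f x + height x * potential1 i f x.
Proof.
move=> af hx.
have i0 : tlambda.-integrable [set: boundary] (EFin \o (fun y => weight x y * f y)).
  exact: tame_integrable (@tame_weight R m) af hx (near_point_refl hx).
have i1 : tlambda.-integrable [set: boundary] (EFin \o (fun y => kernel1 i x y * f y)).
  exact: tame_integrable (@tame_kernel1 R m i) af hx (near_point_refl hx).
rewrite /potential /potential1 -!RintegralZl//.
rewrite -RintegralD//; last 2 first.
- exact: (integrableZl measurableT (b * (i == ord_max)%:R) i0).
- exact: (integrableZl measurableT (height x) i1).
apply: eq_Rintegral => y _.
rewrite /gradient_density /kernel1 direction_max; ring.
Qed.

Lemma gradient_power_potential b f u x : admissible f -> half_space x ->
  (forall z, half_space z -> u z = c * (height z `^ b * potential f z)) ->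
  has_gradient u x /\ gradient u x = gradient_field b f x.
Proof.
move=> af hx uE.
have D i : is_derive x (e_ i) u (gradient_field b f x ord0 i).
  apply: (@near_eq_is_derive _ _ _
    (cst c * (((fun s : R => s `^ b) \o @height R m) * potential f))).
    by apply: filterS (half_space_near hx) => z hz; rewrite uE.
  have D1 : is_derive x (e_ i) ((fun s : R => s `^ b) \o @height R m)
      (b * height x `^ (b - 1) * (i == ord_max)%:R).
    by apply: is_derive_comp1; [exact: is_derive1_powR|exact: is_derive_height].
  have D2 := is_derive_potential i af hx.
  apply: is_derive_eq; rewrite /GRing.scale/= !fctE/= mxE integral_gradient_density//.
  have -> : height x `^ b = height x `^ (b - 1) * height x.
    by rewrite -{3}[height x]powRr1 ?ltW// -powRD ?subrK// (lt0r_neq0 hx) implybT.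
  ring.
split; first by move=> i; have [] := D i.
by apply/rowP => i; rewrite mxE; have Di := D i; rewrite derive_val.
Qed.

(** The restriction to the boundary of the similarity of the half-space that carries
    the apex to [x]. *)
Definition chart x : boundary -> boundary :=
  dilate (height x) (fun k => x ord0 (widen_ord (leqnSn m) k)).

Lemma offset_chart i x y : offset i x (chart x y) = height x * offset i (apex R m) y.
Proof.
case: (unliftP ord_max i) => [k ->|->]; last by rewrite !offset_max height_apex mulrN1.
have -> : lift ord_max k = widen_ord (leqnSn m) k by apply/val_inj; rewrite /= /bump leqNgt ltn_ord.
rewrite /offset !mxE eqxx/=.
have -> : (widen_ord (leqnSn m) k == ord_max) = false by rewrite -val_eqE/= ltn_eqF.
rewrite subr0 -[LHS]/(nth 0 (chart x y) k - _) -[in RHS]/(nth 0 y k).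
by rewrite -!tnth_nth tnth_mktuple perm1 addrK.
Qed.

Lemma dist2_chart x y : dist2 x (chart x y) = height x ^+ 2 * dist2 (apex R m) y.
Proof.
by rewrite /dist2 mulr_sumr; apply: eq_bigr => i _; rewrite offset_chart exprMn.
Qed.

Lemma inv_dist_chart x y : half_space x ->
  inv_dist x (chart x y) = (height x)^-1 * inv_dist (apex R m) y.
Proof.
move=> hx; rewrite /inv_dist dist2_chart powRM ?dist2_ge0 ?sqr_ge0//; congr (_ * _).
by rewrite powRN powR12_sqrt ?sqr_ge0// sqrtr_sqr gtr0_norm.
Qed.

Lemma direction_chart i x y : half_space x ->
  direction i x (chart x y) = direction i (apex R m) y.
Proof.
move=> hx; rewrite /direction offset_chart inv_dist_chart//; field.
by rewrite gt_eqF.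
Qed.

Lemma weight_chart x y : half_space x ->
  weight x (chart x y) = height x ^- n * weight (apex R m) y.
Proof. by move=> hx; rewrite /weight inv_dist_chart// exprMn exprVn. Qed.

Lemma integral_chart x (k : boundary -> R) : half_space x ->
  tlambda.-integrable [set: boundary] (EFin \o k) ->
  \int[tlambda]_y k y = height x ^+ m * \int[tlambda]_y k (chart x y).
Proof.
move=> hx ik; have tm0 : 0 <= height x ^- m by rewrite invr_ge0 exprn_ge0// ltW.
rewrite (Rintegral_scaled (measurable_dilate _ _) tm0 (lebesgue_dilate _ hx))//.
by rewrite mulrA divff ?mul1r// expf_neq0// gt_eqF.
Qed.

(** The kernel is homogeneous of degree - n, the change of variables contributes
    h^(n - 1), and h^(b - 1) is 1 at the apex. *)
Lemma gradient_field_chart b f x : admissible f -> half_space x ->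
  gradient_field b f x = height x `^ (b - 2) *: gradient_field b (f \o chart x) (apex R m).
Proof.
move=> af hx; apply/rowP => i; rewrite !mxE height_apex powR1 mul1r.
set k := fun y => gradient_density b i x y * weight x y * f y.
have ik : tlambda.-integrable [set: boundary] (EFin \o k).
  exact: tame_integrable (locally_dominatedM (tame_factor_gradient_density b i) (@tame_weight R m))
    af hx (near_point_refl hx).
have tm0 : 0 <= height x ^- m by rewrite invr_ge0 exprn_ge0// ltW.
have ikc : tlambda.-integrable [set: boundary] (EFin \o (k \o chart x)).
  exact: (integrable_scaled (measurable_dilate _ _) tm0 (lebesgue_dilate _ hx)).
rewrite (integral_chart hx ik).
have -> : \int[tlambda]_y
      (gradient_density b i (apex R m) y * weight (apex R m) y * (f \o chart x) y)
    = height x ^+ n * \int[tlambda]_y k (chart x y).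
  rewrite -RintegralZl//; apply: eq_Rintegral => y _.
  rewrite /k /gradient_density !direction_chart// weight_chart//=; field.
  by rewrite expf_neq0// gt_eqF.
have -> : height x `^ (b - 1) = height x `^ (b - 2) * height x.
  rewrite -{3}[height x]powRr1 ?ltW// -powRD ?(lt0r_neq0 hx) ?implybT//.
  by congr (_ `^ _); ring.
rewrite exprS; ring.
Qed.

Lemma euclidean_normZ (a : R) x : euclidean_norm (a *: x) = `|a| * euclidean_norm x.
Proof.
rewrite /euclidean_norm -sqrtr_sqr -sqrtrM ?sqr_ge0//; congr Num.sqrt.
by rewrite mulr_sumr; apply: eq_bigr => i _; rewrite mxE exprMn.
Qed.

Lemma euclidean_norm_le x (B : R) : (forall i, `|x ord0 i| <= B) ->
  euclidean_norm x <= Num.sqrt (B ^+ 2 *+ n).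
Proof.
move=> xB; rewrite /euclidean_norm ler_wsqrtr// -[n in leRHS]card_ord -sumr_const.
apply: ler_sum => i _; rewrite -(ger0_norm (sqr_ge0 (x ord0 i))) normrX.
by rewrite lerXn2r ?nnegrE// (le_trans _ (xB i)).
Qed.

Lemma measurable_gradient_density b i x :
  half_space x -> measurable_fun [set: boundary] (gradient_density b i x).
Proof. by move=> hx; have [md _ _] := tame_factor_gradient_density b i; exact: md. Qed.

Lemma norm_gradient_density b i x y : half_space x ->
  `|gradient_density b i x y| <= `|b| + n%:R.
Proof.
move=> hx; rewrite (le_trans (ler_normB _ _))// lerD//.
  by rewrite normrM ler_piMr//; case: (_ == _); rewrite ?normr1 ?normr0 ?ler01.
rewrite normrM ger0_norm// ler_piMr// normrM mulr_ile1// norm_direction//.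
Qed.

Lemma gradient_field_apex_bound b p : (1 <= p)%E ->
  exists2 M : R, 0 <= M & forall f, Lp p f ->
    euclidean_norm (gradient_field b f (apex R m)) <= M * Lp_norm p f.
Proof.
move=> p1; have c0 : 0 < c by rewrite divr_gt0// sphere_area_gt0.
pose B := c * ((`|b| + n%:R) * (sphere_area R m / 2 + 1)).
have B0 : 0 <= B.
  by rewrite mulr_ge0 ?(ltW c0)// mulr_ge0 ?addr_ge0// divr_ge0// ltW// sphere_area_gt0.
exists (B * Num.sqrt n%:R); first by rewrite mulr_ge0 ?sqrtr_ge0.
move=> f fL; have N0 := Lp_norm_ge0 p f.
apply: le_trans (euclidean_norm_le (B := B * Lp_norm p f) _) _.
  move=> i; rewrite !mxE height_apex powR1 mul1r normrM gtr0_norm//.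
  rewrite /B -[leRHS]mulrA ler_wpM2l ?(ltW c0)// -[leRHS]mulrA.
  apply: weighted_integral_bound => //.
    by apply: measurable_gradient_density; exact: half_space_apex.
  by move=> y; apply: norm_gradient_density; exact: half_space_apex.
rewrite -mulr_natr sqrtrM ?sqr_ge0// sqrtr_sqr [`|_ * _|]ger0_norm ?(mulr_ge0 B0 N0)//.
by rewrite mulrAC.
Qed.

Lemma Lp_cst1 : Lp +oo%E (cst 1 : boundary -> R) /\
  Lp_norm +oo%E (cst 1 : boundary -> R) = 1.
Proof.
have E : Lnorm tlambda +oo%E (EFin \o (cst 1 : boundary -> R)) = 1%E.
  rewrite unlock lebesgue_tupleT_gt0.
  have -> : abse \o (EFin \o (cst 1 : boundary -> R)) = cst 1%E.
    by apply/funext => y /=; rewrite normr1.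
  by rewrite ess_sup_cst// lebesgue_tupleT_gt0.
split; last by rewrite /Lp_norm E.
by apply/LpE; split => //; rewrite E ltry.
Qed.

(** Without such a function the set of [ratios] would be empty and every number
    would be an admissible constant. *)
Lemma Lp_nontrivial p : (1 <= p)%E -> exists2 g : boundary -> R, Lp p g & 0 < Lp_norm p g.
Proof.
case: p => [r| |]//; last first.
  by move=> _; have [L N1] := Lp_cst1; exists (cst 1); rewrite ?N1.
rewrite lee_fin => r1; have r0 : 0 < r by exact: lt_le_trans r1.
pose B := @cube R m 1; pose g : boundary -> R := \1_B.
have mB : measurable B by exact: measurable_box.
have E : (\int[tlambda]_y (`|g y| `^ r)%:E = (2 ^+ m)%:E)%E.
  transitivity (\int[tlambda]_y (\1_B y)%:E)%E.
    apply: eq_integral => y _; congr _%:E; rewrite /g indicE.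
    by case: (_ \in _); rewrite ?normr1 ?powR1// normr0 powR0// gt_eqF.
  by rewrite integral_indic// setIT; have := @lebesgue_tuple_cube R m 1; rewrite -natrD.
have L : Lp r%:E g.
  apply/LpE; split; first exact: measurable_indic.
  rewrite unlock (_ : integral _ _ _ = (2 ^+ m)%:E); last by rewrite -E.
  by rewrite poweR_EFin ltry.
exists g => //; rewrite lt_def Lp_norm_ge0 andbT; apply/negP => /eqP N0.
have := integral_powR_norm r1 L; rewrite N0 E powR0 ?gt_eqF// => -[/eqP].
by rewrite expf_eq0 pnatr_eq0 andbF.
Qed.

Definition ratios b p : set R :=
  [set v | exists g, [/\ Lp p g, 0 < Lp_norm p g &
    v = euclidean_norm (gradient_field b g (apex R m)) / Lp_norm p g]].

Definition sharp_constant b p : R := sup (ratios b p).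

Lemma sharp_constant_bound b p f : (1 <= p)%E -> Lp p f ->
  euclidean_norm (gradient_field b f (apex R m)) <= sharp_constant b p * Lp_norm p f.
Proof.
move=> p1 fL; have [M M0 MP] := gradient_field_apex_bound b p1.
have := Lp_norm_ge0 p f; rewrite le_eqVlt => /predU1P[N0|N0].
  by rewrite -N0 mulr0; apply: le_trans (MP f fL) _; rewrite -N0 mulr0.
rewrite -ler_pdivrMr//; apply: ub_le_sup; last by exists f.
by exists M => _ [g [gL Ng ->]]; rewrite ler_pdivrMr// MP.
Qed.

Lemma sharp_constant_le b p (C : R) : (1 <= p)%E ->
  (forall f, Lp p f -> euclidean_norm (gradient_field b f (apex R m)) <= C * Lp_norm p f) ->
  sharp_constant b p <= C.
Proof.
move=> p1 CP; apply: ge_sup.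
  by have [g gL Ng] := Lp_nontrivial p1; exists (euclidean_norm (gradient_field b g (apex R m)) / Lp_norm p g), g.
by move=> _ [g [gL Ng ->]]; rewrite ler_pdivrMr// CP.
Qed.

(** Composition with [chart x] is a bijection of L^p that multiplies the norm by
    h^(- (n - 1) / p), and by [gradient_field_chart] it reduces the gradient at [x]
    to the gradient at the apex, with the factor h^(b - 2). *)
Lemma sharp_gradient_constant_transfer (T : Type) (A : set T) (u : T -> point -> R)
    (bd : T -> R) (trace : T -> boundary -> R) b p x :
  (1 <= p)%E -> half_space x ->
  (forall a, A a -> Lp p (trace a)) ->
  (forall f, Lp p f -> exists2 a, A a & trace a = f) ->
  (forall a z, A a -> half_space z ->
    u a z = c * (height z `^ b * potential (trace a) z)) ->
  (forall a, bd a = height x `^ (b - 2 - codim_over m p) * Lp_norm p (trace a)) ->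
  sharp_gradient_constant A u bd x (sharp_constant b p).
Proof.
move=> p1 hx AL LA uE bdE.
have G a : A a -> has_gradient (u a) x /\ gradient (u a) x = gradient_field b (trace a) x.
  move=> Aa; apply: gradient_power_potential => //.
    exact: Lp_admissible (AL _ Aa).
  by move=> z hz; exact: uE.
have h2 : 0 < height x `^ (b - 2) by exact: powR_gt0.
have E f : Lp p f -> euclidean_norm (gradient_field b f x)
    = height x `^ (b - 2) * euclidean_norm (gradient_field b (f \o chart x) (apex R m)).
  move=> fL; rewrite gradient_field_chart//; last exact: Lp_admissible fL.
  by rewrite euclidean_normZ gtr0_norm.
have bdE' a : A a -> bd a = height x `^ (b - 2) * Lp_norm p (trace a \o chart x).
  move=> Aa; rewrite bdE.
  have [_ ->] := Lp_dilate (fun k => x ord0 (widen_ord (leqnSn m) k)) hx p1 (AL _ Aa).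
  by rewrite mulrA -powRD// (lt0r_neq0 hx) implybT.
have CL f : Lp p f -> Lp p (f \o chart x).
  by move=> fL; have [] := Lp_dilate (fun k => x ord0 (widen_ord (leqnSn m) k)) hx p1 fL.
split.
- by move=> a /G[].
- move=> a Aa; have [_ ->] := G a Aa; rewrite (E _ (AL _ Aa)) (bdE' _ Aa) mulrCA ler_pM2l//.
  by apply: sharp_constant_bound => //; exact/CL/AL.
- move=> C' C'P; apply: sharp_constant_le => // g gL.
  have hx' : 0 < (height x)^-1 by rewrite invr_gt0.
  have [gL' _] := Lp_dilate (fun k => - (x ord0 (widen_ord (leqnSn m) k) / height x)) hx' p1 gL.
  have [a Aa aE] := LA _ gL'.
  have aE' : trace a \o chart x = g.
    by rewrite aE; apply/funext => y /=; congr g; exact: dilateK.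
  have := C'P a Aa; have [_ ->] := G a Aa.
  by rewrite (E _ (AL _ Aa)) (bdE' _ Aa) aE' mulrCA ler_pM2l.
Qed.

End GradientField.

(** * The harmonic measure seen from the apex *)

Section HarmonicMeasure.
Variables (R : realType) (m : nat).
Local Notation RM := (measurableTypeR R).
Local Notation point := ('rV[R]_m.+1).
Local Notation boundary := (m.-tuple RM).
Local Notation tlambda := (lebesgue_tuple R m).
Local Notation n := (m.+1).
Local Notation c := (2 / sphere_area R m).
Local Notation apex := (apex R m).
Implicit Types (x z : point) (y : boundary) (f g : boundary -> R) (b : R).

Definition bounded_measurable g : Prop :=
  measurable_fun [set: boundary] g /\ exists B, forall y, `|g y| <= B.

(** The mean for the harmonic measure of the half-space seen from the apex, whose
    density is the Poisson kernel. *)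
Definition average g : R := c * \int[tlambda]_y (weight apex y * g y).

Lemma poisson_constant_gt0 : 0 < c. Proof. by rewrite divr_gt0// sphere_area_gt0. Qed.

Lemma bounded_measurableD g k : bounded_measurable g -> bounded_measurable k ->
  bounded_measurable (fun y => g y + k y).
Proof.
move=> [mg [B gB]] [mk [D kD]]; split; first exact: measurable_funD.
by exists (B + D) => y; rewrite (le_trans (ler_normD _ _))// lerD.
Qed.

Lemma bounded_measurableM g k : bounded_measurable g -> bounded_measurable k ->
  bounded_measurable (fun y => g y * k y).
Proof.
move=> [mg [B gB]] [mk [D kD]]; split; first exact: measurable_funM.
by exists (B * D) => y; rewrite normrM ler_pM.
Qed.

Lemma bounded_measurable_cst (a : R) : bounded_measurable (fun=> a).
Proof. by split; [exact: measurable_cst|exists `|a|]. Qed.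

Lemma bounded_measurable_sum N (F : 'I_N -> boundary -> R) :
  (forall i, bounded_measurable (F i)) -> bounded_measurable (fun y => \sum_i F i y).
Proof.
elim: N F => [|N IH] F bF.
  rewrite (_ : (fun y => _) = (fun=> 0)); first exact: bounded_measurable_cst.
  by apply/funext => y; rewrite big_ord0.
rewrite (_ : (fun y => _) = (fun y => F ord0 y + \sum_i F (lift ord0 i) y)).
  by apply: bounded_measurableD => //; exact: IH.
by apply/funext => y; rewrite big_ord_recl.
Qed.

Lemma bounded_measurable_norm g : bounded_measurable g -> bounded_measurable (fun y => `|g y|).
Proof.
move=> [mg [B gB]]; split; first exact: measurableT_comp.
by exists B => y; rewrite normr_id.
Qed.

Lemma bounded_measurable_direction i : bounded_measurable (direction i apex).
Proof.
split; first exact: measurable_direction.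
by exists 1 => y; rewrite norm_direction//; exact: half_space_apex.
Qed.

Lemma average_integrable g : bounded_measurable g ->
  tlambda.-integrable [set: boundary] (EFin \o (fun y => weight apex y * g y)).
Proof.
move=> [mg [B gB]].
have mw : measurable_fun [set: boundary] (weight apex) by exact: measurable_weight.
have iw : tlambda.-integrable [set: boundary] (EFin \o weight apex).
  apply/integrableP; split; first exact/measurable_EFinP.
  under eq_integral do rewrite /= ger0_norm ?weight_ge0//.
  by rewrite integral_weight_apex ltry.
apply: (@le_integrable _ _ _ _ _ measurableT _ (fun y => (B * weight apex y)%:E)).
- by apply/measurable_EFinP; exact: measurable_funM.
- move=> y _ /=; rewrite lee_fin mulrC !normrM ler_wpM2r//.
  by rewrite (le_trans (gB y))// ler_norm.
- exact: (integrableZl measurableT B iw).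
Qed.

Lemma averageD g k : bounded_measurable g -> bounded_measurable k ->
  average (fun y => g y + k y) = average g + average k.
Proof.
move=> bg bk; rewrite /average -mulrDr -RintegralD//; last 2 first.
- exact: average_integrable.
- exact: average_integrable.
by congr (_ * _); apply: eq_Rintegral => y _; rewrite mulrDr.
Qed.

Lemma averageZ (a : R) g : bounded_measurable g ->
  average (fun y => a * g y) = a * average g.
Proof.
move=> bg; rewrite /average [RHS]mulrCA; congr (_ * _).
rewrite -RintegralZl//; last exact: average_integrable.
by apply: eq_Rintegral => y _; rewrite mulrCA.
Qed.

Lemma average_cst (a : R) : average (fun=> a) = a.
Proof.
rewrite -[X in average (fun=> X)]mulr1 (averageZ a (bounded_measurable_cst 1)).
rewrite /average /Rintegral.
under eq_integral do rewrite mulr1.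
rewrite integral_weight_apex/=; field.
by rewrite gt_eqF// sphere_area_gt0.
Qed.

Lemma average_sum N (F : 'I_N -> boundary -> R) :
  (forall i, bounded_measurable (F i)) ->
  average (fun y => \sum_i F i y) = \sum_i average (F i).
Proof.
elim: N F => [|N IH] F bF.
  by rewrite big_ord0 -[RHS](average_cst 0); congr average; apply/funext => y; rewrite big_ord0.
rewrite big_ord_recl -IH// -averageD//; last exact: bounded_measurable_sum.
by congr average; apply/funext => y; rewrite big_ord_recl.
Qed.

Lemma average_le g k : bounded_measurable g -> bounded_measurable k ->
  (forall y, g y <= k y) -> average g <= average k.
Proof.
move=> bg bk gk; rewrite /average ler_wpM2l ?(ltW poisson_constant_gt0)//.
apply: le_Rintegral => //; [exact: average_integrable|exact: average_integrable|].
by move=> y _; rewrite ler_wpM2l ?weight_ge0.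
Qed.

Lemma average_bound f k : Lp +oo%E f -> bounded_measurable k ->
  `|c * \int[tlambda]_y (k y * weight apex y * f y)|
  <= average (fun y => `|k y|) * Lp_norm +oo%E f.
Proof.
move=> fL bk; have [mk [B kB]] := bk; have /LpE[mf _] := fL.
have mw : measurable_fun [set: boundary] (weight apex) by exact: measurable_weight.
have N0 := Lp_norm_ge0 +oo%E f.
have bak := bounded_measurable_norm bk.
have ki := bounded_weighted_integrable (leey 1%E) fL mk kB.
rewrite normrM (gtr0_norm poisson_constant_gt0) /average -[leRHS]mulrA ler_wpM2l ?(ltW poisson_constant_gt0)//.
rewrite (le_trans (le_normr_Rintegral measurableT ki))//.
rewrite mulrC -RintegralZl//; last exact: average_integrable.
rewrite /Rintegral fine_le//.
- by apply: integrable_fin_num => //; exact: (integrable_norm ki).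
- apply: integrable_fin_num => //.
  exact: (integrableZl measurableT (Lp_norm +oo%E f) (average_integrable bak)).
apply: ae_ge0_le_integral => //.
- by apply/measurable_EFinP; apply: measurableT_comp => //; do 2 apply: measurable_funM => //.
- by move=> y _; rewrite lee_fin !mulr_ge0 ?weight_ge0.
- apply/measurable_EFinP; do 2 apply: measurable_funM => //.
  exact: measurableT_comp.
- have := ess_sup_ge tlambda (abse \o (EFin \o f)).
  have := Lp_normE fL; rewrite unlock lebesgue_tupleT_gt0 => ->.
  apply: filterS => y /=; rewrite lee_fin => fy _.
  rewrite lee_fin !normrM [`|weight _ _|]ger0_norm ?weight_ge0//.
  by rewrite mulrC [`|k y| * _]mulrC ler_wpM2r// mulr_ge0 ?weight_ge0.
Qed.

Section Symmetry.
Variables (s : {perm 'I_m}) (a : 'I_m -> R).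
Hypothesis a1 : forall k, `|a k| = 1.

(** The linear isometries of the boundary that permute the coordinates and change
    their signs; they fix the apex, hence preserve the harmonic measure. *)
Definition symmetry : boundary -> boundary := affine_perm s a (fun=> 0).

Lemma symmetry_sqnorm y : sqnorm (symmetry y) = sqnorm y.
Proof.
rewrite /sqnorm [RHS](reindex_inj (@perm_inj _ s)); apply: eq_bigr => k _.
rewrite tnth_mktuple addr0 exprMn -[a k ^+ 2]ger0_norm ?sqr_ge0//.
by rewrite normrX a1 expr1n mul1r.
Qed.

Lemma symmetry_inv_dist y : inv_dist apex (symmetry y) = inv_dist apex y.
Proof. by rewrite /inv_dist !dist2_apex symmetry_sqnorm. Qed.

Lemma symmetry_direction (k : 'I_m) y :
  direction (widen_ord (leqnSn m) k) apex (symmetry y)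
  = a k * direction (widen_ord (leqnSn m) (s k)) apex y.
Proof.
have E (l : 'I_m) (v : boundary) : direction (widen_ord (leqnSn m) l) apex v
    = tnth v l * inv_dist apex v.
  rewrite /direction /offset !mxE eqxx/=.
  have -> : (widen_ord (leqnSn m) l == ord_max) = false by rewrite -val_eqE/= ltn_eqF.
  by rewrite subr0 (tnth_nth 0).
by rewrite !E symmetry_inv_dist tnth_mktuple addr0 mulrA.
Qed.

Lemma average_symmetry g : bounded_measurable g ->
  average (fun y => g (symmetry y)) = average g.
Proof.
move=> bg; rewrite /average; congr (_ * _).
have inv (A : set boundary) : measurable A ->
    tlambda (symmetry @^-1` A) = (1%:E * tlambda A)%E.
  move=> mA; rewrite lebesgue_tuple_affine_perm//; last first.
    by move=> k; rewrite -normr_gt0 a1.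
  by rewrite big1// => k _; rewrite a1 invr1.
rewrite -[RHS]mul1r -(Rintegral_scaled (measurable_affine_perm s a _) ler01 inv).
  by apply: eq_Rintegral => y _; rewrite /weight -symmetry_inv_dist.
exact: average_integrable.
Qed.

End Symmetry.

Lemma admissible_cst1 : admissible (cst 1 : boundary -> R).
Proof. by have [L _] := Lp_cst1 R m; exact: Lp_admissible (leey 1%E) L. Qed.

(** The Poisson integral of 1 is 1: at the apex this is [average_cst], elsewhere it
    follows by [chart]. *)
Lemma potential_cst1 x : half_space x -> c * (height x `^ 1 * potential (cst 1) x) = 1.
Proof.
move=> hx; have h0 : height x != 0 by rewrite gt_eqF.
have [_ ia] := admissible_cst1.
rewrite /potential (integral_chart hx (ia x hx)).
rewrite (_ : \int[tlambda]_y _ = height x ^- n * \int[tlambda]_y (weight apex y * 1)).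
  have := average_cst 1; rewrite /average; set I := Rintegral _ _ _ => cI.
  rewrite -[RHS]cI powRr1 ?(ltW hx)//; congr (_ * _).
  by rewrite exprS; field; rewrite h0 expf_neq0.
rewrite -RintegralZl//; last exact: ia (half_space_apex R m).
by apply: eq_Rintegral => y _; rewrite weight_chart// mulrA.
Qed.

Lemma gradient_field_average b i : gradient_field b (cst 1) apex ord0 i
  = b * (i == ord_max)%:R
    - n%:R * average (fun y => direction ord_max apex y * direction i apex y).
Proof.
have bd j := bounded_measurable_direction j.
rewrite mxE height_apex powR1 mul1r.
transitivity (average (gradient_density b i apex)).
  by congr (_ * _); apply: eq_Rintegral => y _; rewrite mulr1 mulrC.
rewrite /gradient_density averageD; last 2 first.
- exact: bounded_measurable_cst.
- rewrite (_ : (fun y => _) = (fun y => - n%:R * (direction ord_max apex y * direction i apex y))).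
    apply: bounded_measurableM; first exact: bounded_measurable_cst.
    exact: bounded_measurableM.
  by apply/funext => y; rewrite mulNr.
rewrite average_cst; congr (_ + _); rewrite -mulNr -averageZ; last exact: bounded_measurableM.
by congr average; apply/funext => y; rewrite mulNr.
Qed.

(** The function c h Q 1 is constant, so its gradient at the apex vanishes. By
    [gradient_field_average] with b = 1 its i-th component is the difference of the
    two sides. *)
Lemma second_moment_normal i :
  n%:R * average (fun y => direction ord_max apex y * direction i apex y) = (i == ord_max)%:R.
Proof.
have [_ G] := gradient_power_potential admissible_cst1 (half_space_apex R m)
  (u := cst 1) (b := 1) (fun z hz => esym (potential_cst1 hz)).
have := congr1 (fun v : point => v ord0 i) G; rewrite gradient_field_average mul1r.
by rewrite mxE derive_cst => /esym/eqP; rewrite subr_eq0 => /eqP.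
Qed.

Lemma gradient_field_cst1 b i :
  gradient_field b (cst 1) apex ord0 i = (b - 1) * (i == ord_max)%:R.
Proof. by rewrite gradient_field_average second_moment_normal mulrBl mul1r. Qed.

(** For k != l, the reflection of the k-th coordinate changes the sign of the mean.
    For k = l, exchanges of coordinates show that the m tangential moments are equal,
    and together with the normal one they sum to 1. *)
Lemma second_moment_tangential (k l : 'I_m) :
  n%:R * average (fun y => direction (widen_ord (leqnSn m) k) apex y
    * direction (widen_ord (leqnSn m) l) apex y) = (k == l)%:R.
Proof.
pose w := widen_ord (leqnSn m).
pose M (k l : 'I_m) := average (fun y => direction (w k) apex y * direction (w l) apex y).
have bM (i j : 'I_n) : bounded_measurable (fun y => direction i apex y * direction j apex y).
  by apply: bounded_measurableM; exact: bounded_measurable_direction.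
rewrite -/w -/(M k l); have [<-|kl] := eqVneq k l; last first.
  (* reflection of the k-th coordinate *)
  pose a (i : 'I_m) : R := if i == k then -1 else 1.
  have a1 i : `|a i| = 1 by rewrite /a; case: ifP => _; rewrite ?normrN normr1.
  suff /eqP : M k l = - M k l by rewrite -addr_eq0 -mulr2n mulrn_eq0 => /eqP ->; rewrite mulr0.
  rewrite {1}/M -(average_symmetry 1%g a1)// -[RHS]mulN1r -averageZ//.
  congr average; apply/funext => y; rewrite !symmetry_direction//= !perm1 /a eqxx.
  by rewrite eq_sym (negbTE kl) mul1r mulrA.
have MM (i : 'I_m) : M i i = M k k.
  pose a (j : 'I_m) : R := 1.
  have a1 j : `|a j| = 1 by rewrite normr1.
  rewrite /M -(average_symmetry (tperm i k) a1 (bM (w i) (w i))); congr (average _).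
  by apply/funext => y; rewrite !symmetry_direction// (mul1r (direction _ _ _)) tpermL.
have m0 : 0 < (m%:R : R) by rewrite ltr0n (leq_ltn_trans (leq0n k)).
have := average_cst 1.
rewrite (_ : (fun=> 1) = (fun y => \sum_i direction i apex y * direction i apex y)); last first.
  apply/funext => y; rewrite -(sum_direction2 y (half_space_apex R m)).
  by apply: eq_bigr => i _; rewrite expr2.
rewrite average_sum// big_ord_recr/=.
under eq_bigr do rewrite -/(w _) -/(M _ _) MM.
rewrite sumr_const card_ord -[M k k *+ _]mulr_natl.
have := second_moment_normal ord_max; rewrite eqxx.
set A := average _; rewrite -[n%:R]natr1 => nA sA.
have : m%:R * ((m%:R + 1) * M k k - 1) = 0.
  have -> : m%:R * ((m%:R + 1) * M k k - 1) = (m%:R + 1) * (m%:R * M k k + A - 1) - ((m%:R + 1) * A - 1).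
    ring.
  by rewrite sA subrr mulr0 nA subrr subrr.
move/eqP; rewrite mulf_eq0 gt_eqF//= subr_eq0 => /eqP H.
exact: H.
Qed.

Lemma second_moment i j :
  n%:R * average (fun y => direction i apex y * direction j apex y) = (i == j)%:R.
Proof.
have W (l : 'I_m) : lift ord_max l = widen_ord (leqnSn m) l.
  by apply/val_inj; rewrite /= /bump leqNgt ltn_ord.
case: (unliftP ord_max i) => [k ->|->]; last by rewrite second_moment_normal eq_sym.
case: (unliftP ord_max j) => [l ->|->].
  by rewrite (inj_eq lift_inj) !W second_moment_tangential.
rewrite -second_moment_normal; congr (_ * average _).
by apply/funext => y; rewrite mulrC.
Qed.

Lemma second_moment_unit z : \sum_i z ord0 i ^+ 2 = 1 ->
  n%:R * average (fun y => (\sum_i z ord0 i * direction i apex y) ^+ 2) = 1.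
Proof.
move=> z1.
have bd i j : bounded_measurable (fun y => direction i apex y * direction j apex y).
  by apply: bounded_measurableM; exact: bounded_measurable_direction.
have bc (a : R) i j : bounded_measurable (fun y => a * (direction i apex y * direction j apex y)).
  by apply: bounded_measurableM => //; exact: bounded_measurable_cst.
rewrite (_ : (fun y => _) = (fun y => \sum_i \sum_j
    z ord0 i * z ord0 j * (direction i apex y * direction j apex y))); last first.
  apply/funext => y; rewrite expr2 mulr_suml; apply: eq_bigr => i _.
  by rewrite mulr_sumr; apply: eq_bigr => j _; ring.
rewrite average_sum; last by move=> i; exact: bounded_measurable_sum.
rewrite -[RHS]z1 mulr_sumr; apply: eq_bigr => i _.
rewrite average_sum// mulr_sumr (bigD1 i)//= big1 ?addr0.
  by rewrite averageZ// (mulrCA n%:R) second_moment eqxx mulr1 expr2.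
by move=> j ji; rewrite averageZ// (mulrCA n%:R) second_moment eq_sym (negbTE ji) mulr0.
Qed.

End HarmonicMeasure.

(** * The sharp constants for bounded data *)

Section SharpConstants.
Variables (R : realType) (m : nat).
Local Notation RM := (measurableTypeR R).
Local Notation point := ('rV[R]_m.+1).
Local Notation boundary := (m.-tuple RM).
Local Notation tlambda := (lebesgue_tuple R m).
Local Notation n := (m.+1).
Local Notation c := (2 / sphere_area R m).
Local Notation apex := (apex R m).
Implicit Types (x z : point) (y : boundary) (f g : boundary -> R) (b : R).

Definition directional z y : R := \sum_i z ord0 i * direction i apex y.

Lemma bounded_measurable_gradient_density b i : bounded_measurable (gradient_density b i apex).
Proof.
split; first exact: measurable_gradient_density (half_space_apex R m).
by exists (`|b| + n%:R) => y; apply: norm_gradient_density; exact: half_space_apex.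
Qed.

Lemma sum_gradient_density b z y : \sum_i z ord0 i * gradient_density b i apex y
  = b * z ord0 ord_max - n%:R * (direction ord_max apex y * directional z y).
Proof.
under eq_bigr do rewrite mulrBr; rewrite sumrB; congr (_ - _).
  rewrite (bigD1 ord_max)//= eqxx mulr1 big1 ?addr0; first by rewrite mulrC.
  by move=> i /negbTE ->; rewrite !mulr0.
by rewrite /directional !mulr_sumr; apply: eq_bigr => i _; ring.
Qed.

(** The length of the gradient is its component in its own direction [z]. *)
Lemma gradient_field_norm_bound b (K : R) f : 0 <= K ->
  (forall z, \sum_i z ord0 i ^+ 2 = 1 ->
    average (fun y => `|\sum_i z ord0 i * gradient_density b i apex y|) <= K) ->
  Lp +oo%E f -> euclidean_norm (gradient_field b f apex) <= K * Lp_norm +oo%E f.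
Proof.
move=> K0 KP fL; have af := Lp_admissible (leey 1%E) fL.
have N0 := Lp_norm_ge0 +oo%E f.
set G := gradient_field b f apex.
have GE i : G ord0 i = c * \int[tlambda]_y (gradient_density b i apex y * weight apex y * f y).
  by rewrite mxE height_apex powR1 mul1r.
have s0 : 0 <= \sum_i G ord0 i ^+ 2 by apply: sumr_ge0 => i _; exact: sqr_ge0.
have [->|e0] := eqVneq (euclidean_norm G) 0; first exact: mulr_ge0.
have e_gt0 : 0 < euclidean_norm G by rewrite lt_def e0 sqrtr_ge0.
have e2 : \sum_i G ord0 i ^+ 2 = euclidean_norm G ^+ 2 by rewrite sqr_sqrtr.
(* the unit vector along the gradient *)
pose z : point := (euclidean_norm G)^-1 *: G.
have z1 : \sum_i z ord0 i ^+ 2 = 1.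
  under eq_bigr do rewrite mxE exprMn.
  by rewrite -mulr_sumr e2 -exprMn mulVf// expr1n.
have -> : euclidean_norm G = \sum_i z ord0 i * G ord0 i.
  under eq_bigr do rewrite mxE -mulrA -expr2.
  by rewrite -mulr_sumr e2 expr2 mulrA mulVf// mul1r.
have -> : \sum_i z ord0 i * G ord0 i
    = c * \int[tlambda]_y ((\sum_i z ord0 i * gradient_density b i apex y) * weight apex y * f y).
  have gi i : tlambda.-integrable [set: boundary]
      (EFin \o (fun y => z ord0 i * (gradient_density b i apex y * weight apex y * f y))).
    apply: (integrableZl measurableT (z ord0 i)
      (f := fun y => (gradient_density b i apex y * weight apex y * f y)%:E)).
    exact: tame_integrable (locally_dominatedM (tame_factor_gradient_density b i) (@tame_weight R m))
      af (half_space_apex R m) (near_point_refl (half_space_apex R m)).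
  transitivity (c * \sum_i \int[tlambda]_y
      (z ord0 i * (gradient_density b i apex y * weight apex y * f y))).
    rewrite mulr_sumr; apply: eq_bigr => i _; rewrite RintegralZl//.
      by rewrite GE mulrCA.
    exact: tame_integrable (locally_dominatedM (tame_factor_gradient_density b i) (@tame_weight R m))
      af (half_space_apex R m) (near_point_refl (half_space_apex R m)).
  rewrite -Rintegral_sum//; congr (_ * _); apply: eq_Rintegral => y _.
  by rewrite !mulr_suml; apply: eq_bigr => i _; rewrite !mulrA.
apply: le_trans (ler_norm _) _.
apply: le_trans (average_bound fL _) _.
  apply: bounded_measurable_sum => i; apply: bounded_measurableM.
    exact: bounded_measurable_cst.
  exact: bounded_measurable_gradient_density.
by rewrite ler_wpM2r// KP.
Qed.

Lemma bounded_measurable_directional z : bounded_measurable (directional z).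
Proof.
apply: bounded_measurable_sum => i; apply: bounded_measurableM.
  exact: bounded_measurable_cst.
exact: bounded_measurable_direction.
Qed.

(** On the left is the inner product of the projections of e_n and z orthogonal to
    the unit vector d, on the right half the sum of their squared lengths. The proof
    uses the Cauchy-Schwarz inequality between d and z + e_n, z - e_n. *)
Lemma normal_tangential_inequality z y : \sum_i z ord0 i ^+ 2 = 1 ->
  `|z ord0 ord_max - direction ord_max apex y * directional z y|
  <= (2 - direction ord_max apex y ^+ 2 - directional z y ^+ 2) / 2.
Proof.
move=> z1; pose d i := direction i apex y.
have d1 : \sum_i d i ^+ 2 = 1 by exact: sum_direction2 (half_space_apex R m).
have cs (v : 'I_n -> R) : (\sum_i v i * d i) ^+ 2 <= \sum_i v i ^+ 2.
  rewrite -subr_ge0; set s := \sum_i v i * d i.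
  have -> : \sum_i v i ^+ 2 - s ^+ 2 = \sum_i (v i - s * d i) ^+ 2.
    have E i : (v i - s * d i) ^+ 2 = v i ^+ 2 - (2 * s) * (v i * d i) + s ^+ 2 * d i ^+ 2.
      ring.
    under [RHS]eq_bigr do rewrite E.
    rewrite big_split sumrB/= -!mulr_sumr d1 -/s; ring.
  by apply: sumr_ge0 => i _; exact: sqr_ge0.
have [sP sN] : (directional z y + d ord_max) ^+ 2 <= 2 + 2 * z ord0 ord_max /\
    (directional z y - d ord_max) ^+ 2 <= 2 - 2 * z ord0 ord_max.
  have dm (F : 'I_n -> R) : \sum_i (i == ord_max)%:R * F i = F ord_max.
    rewrite (bigD1 ord_max)//= eqxx mul1r big1 ?addr0// => i /negbTE ->.
    by rewrite mul0r.
  have sum2 (a : R) : a ^+ 2 = 1 ->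
      (directional z y + a * d ord_max) ^+ 2 <= 2 + 2 * a * z ord0 ord_max.
    move=> a2; have := cs (fun i => z ord0 i + (i == ord_max)%:R * a).
    have -> : \sum_i (z ord0 i + (i == ord_max)%:R * a) * d i
        = directional z y + a * d ord_max.
      rewrite -(dm (fun i => a * d i)) -big_split; apply: eq_bigr => i _ /=.
      by rewrite mulrDl mulrA.
    have -> : \sum_i (z ord0 i + (i == ord_max)%:R * a) ^+ 2
        = 1 + (1 + 2 * a * z ord0 ord_max).
      rewrite -[X in _ = X + _]z1 -(dm (fun i => 1 + 2 * a * z ord0 i)) -big_split.
      apply: eq_bigr => i _ /=; case: (_ == _); rewrite ?mul0r ?addr0// !mul1r.
      have -> : (z ord0 i + a) ^+ 2 = z ord0 i ^+ 2 + (a ^+ 2 + 2 * a * z ord0 i) by ring.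
      by rewrite a2.
    by rewrite addrA.
  have := sum2 1 (expr1n _ _); have := sum2 (-1); rewrite sqrrN expr1n => /(_ erefl).
  by rewrite mulN1r mul1r mulr1 mulrN1 mulNr.
rewrite -/(d ord_max) in sP sN *.
by rewrite ler_norml; apply/andP; split; nra.
Qed.

Lemma average_quadratic (u v w : R) z :
  average (fun y => u + v * direction ord_max apex y ^+ 2 + w * directional z y ^+ 2)
  = u + v * average (fun y => direction ord_max apex y * direction ord_max apex y)
    + w * average (fun y => directional z y ^+ 2).
Proof.
have bd : bounded_measurable (fun y => direction ord_max apex y * direction ord_max apex y).
  by apply: bounded_measurableM; exact: bounded_measurable_direction.
have bz : bounded_measurable (fun y => directional z y ^+ 2).
  by apply: bounded_measurableM; exact: bounded_measurable_directional.
have bc (a : R) g : bounded_measurable g -> bounded_measurable (fun y => a * g y).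
  by move=> bg; apply: bounded_measurableM => //; exact: bounded_measurable_cst.
have bu := bounded_measurable_cst m u.
rewrite (averageD (bounded_measurableD bu (bc v _ bd)) (bc w _ bz)).
by rewrite (averageD bu (bc v _ bd)) average_cst !averageZ.
Qed.

(** The lower bound comes from f = 1, for which the function is h^(b - 1). *)
Lemma sharp_constant_oo b (K : R) : 0 <= K -> `|b - 1| = K ->
  (forall z, \sum_i z ord0 i ^+ 2 = 1 ->
    average (fun y => `|\sum_i z ord0 i * gradient_density b i apex y|) <= K) ->
  sharp_constant m b +oo%E = K.
Proof.
move=> K0 bK KP; apply/eqP; rewrite eq_le; apply/andP; split.
  apply: sharp_constant_le; first exact: leey.
  by move=> f; exact: gradient_field_norm_bound.
have [L1 N1] := Lp_cst1 R m.
have := sharp_constant_bound b (leey 1%E) L1; rewrite N1 mulr1; apply: le_trans.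
rewrite /euclidean_norm (bigD1 ord_max)//= big1 ?addr0.
  by rewrite gradient_field_cst1 eqxx mulr1 sqrtr_sqr bK.
by move=> i /negbTE ni; rewrite gradient_field_cst1 ni mulr0 expr0n.
Qed.

(** The means of the squares of d_n and of d.z are both 1 / n. *)
Lemma average_density_bound b (u v w : R) z :
  (forall y, `|\sum_i z ord0 i * gradient_density b i apex y|
    <= u + v * direction ord_max apex y ^+ 2 + w * directional z y ^+ 2) ->
  \sum_i z ord0 i ^+ 2 = 1 ->
  average (fun y => `|\sum_i z ord0 i * gradient_density b i apex y|)
  <= u + (v + w) / n%:R.
Proof.
move=> H z1.
have bz : bounded_measurable (fun y => directional z y ^+ 2).
  by apply: bounded_measurableM; exact: bounded_measurable_directional.
have bd : bounded_measurable (fun y => direction ord_max apex y ^+ 2).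
  by apply: bounded_measurableM; exact: bounded_measurable_direction.
have bc (a : R) g : bounded_measurable g -> bounded_measurable (fun y => a * g y).
  by move=> bg; apply: bounded_measurableM => //; exact: bounded_measurable_cst.
apply: (@le_trans _ _ (average (fun y => u + v * direction ord_max apex y ^+ 2
    + w * directional z y ^+ 2))).
  apply: average_le => //.
    apply/bounded_measurable_norm/bounded_measurable_sum => i.
    exact/bc/bounded_measurable_gradient_density.
  apply: bounded_measurableD; last exact: bc.
  by apply: bounded_measurableD; [exact: bounded_measurable_cst|exact: bc].
rewrite average_quadratic.
have n0 : n%:R != 0 :> R by rewrite pnatr_eq0.
have -> : average (fun y => direction ord_max apex y * direction ord_max apex y) = n%:R^-1.
  by apply: (mulfI n0); rewrite second_moment eqxx divff.
have -> : average (fun y => directional z y ^+ 2) = n%:R^-1.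
  by apply: (mulfI n0); rewrite second_moment_unit// divff.
by rewrite mulrDl addrA.
Qed.

(** Here the density is - n d_n (d.z), and 2 |d_n (d.z)| <= d_n^2 + (d.z)^2. *)
Lemma sharp_constant0 : sharp_constant m 0 +oo%E = 1 :> R.
Proof.
have n0 : n%:R != 0 :> R by rewrite pnatr_eq0.
apply: sharp_constant_oo => //; first by rewrite sub0r normrN normr1.
move=> z z1.
rewrite (_ : 1 = 0 + (n%:R / 2 + n%:R / 2) / n%:R); last by field.
apply: average_density_bound => // y.
rewrite sum_gradient_density mul0r sub0r normrN normrM normr_nat add0r.
set d := direction _ _ _; set e := directional _ _.
rewrite (_ : n%:R / 2 * d ^+ 2 + _ = n%:R * ((d ^+ 2 + e ^+ 2) / 2)); last by field.
rewrite ler_wpM2l// ler_norml.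
have := sqr_ge0 (d + e); have := sqr_ge0 (d - e); rewrite sqrrB sqrrD => H1 H2.
by apply/andP; split; lra.
Qed.

Lemma sharp_constant_dim : sharp_constant m n%:R +oo%E = n%:R - 1 :> R.
Proof.
have n0 : n%:R != 0 :> R by rewrite pnatr_eq0.
have n1 : 0 <= n%:R - 1 :> R by rewrite subr_ge0 ler1n.
apply: sharp_constant_oo => //; first by rewrite ger0_norm.
move=> z z1.
rewrite (_ : n%:R - 1 = n%:R + (- (n%:R / 2) + - (n%:R / 2)) / n%:R); last by field.
apply: average_density_bound => // y.
rewrite sum_gradient_density -mulrBr normrM normr_nat.
rewrite (_ : _ + _ + _ = n%:R * ((2 - direction ord_max apex y ^+ 2 - directional z y ^+ 2) / 2));
  last by field.
by rewrite ler_wpM2l// normal_tangential_inequality.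
Qed.

End SharpConstants.

(** * The two gradient inequalities *)

Section Main.
Variables (R : realType) (m : nat).
Local Notation n := (m.+1).
Local Notation c := (2 / sphere_area R m).

(** The factor multiplying the biharmonic solution is only required to agree with
    h^(b - 2), so that integer and real powers are treated alike. *)
Lemma sharp_biharmonic (b : R) (p : \bar R) (u : (m.-tuple (measurableTypeR R) -> R) -> 'rV[R]_n -> R)
    (bd : (m.-tuple (measurableTypeR R) -> R) -> R) (x : 'rV[R]_n) :
  (1 <= p)%E -> half_space x ->
  (forall f z, half_space z -> exists2 s, u f z = s * biharmonic_solution f z
    & s * height z ^+ 2 = height z `^ b) ->
  (forall f, bd f = height x `^ (b - 2 - codim_over m p) * Lp_norm p f) ->
  sharp_gradient_constant (Lp p) u bd x (sharp_constant m b p).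
Proof.
move=> p1 hx uE bdE.
apply: (sharp_gradient_constant_transfer (trace := id)) => //.
  by move=> f fL; exists f.
move=> f z fL hz; have [s -> sE] := uE f z hz.
rewrite biharmonic_solutionE//; last exact: Lp_admissible fL.
by rewrite -sE; ring.
Qed.

End Main.

Theorem mainTheorem14 (R : realType) (m : nat) (hn : (3 <= m.+1)%N) :
  (forall (alpha : R) (p : \bar R), 0 <= alpha -> (1 <= p)%E ->
    exists C : R, forall x : 'rV[R]_m.+1, half_space x ->
      sharp_gradient_constant (Lp p)
        (fun f z => height z `^ (m.+1%:R * alpha - 2) * biharmonic_solution f z)
        (fun f => height x `^ (m.+1%:R * alpha - 2 - codim_over m p) * Lp_norm p f)
        x C
      /\
      sharp_gradient_constant (hp p)
        (fun vg z => height z `^ (m.+1%:R * alpha - 1) * vg.1 z)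
        (fun vg => height x `^ (m.+1%:R * alpha - 2 - codim_over m p) * Lp_norm p vg.2)
        x C)
  /\
  (forall x : 'rV[R]_m.+1, half_space x ->
    sharp_gradient_constant (Lp +oo%E)
      (fun f z => biharmonic_solution f z / height z ^+ 2)
      (fun f => (height x ^+ 2)^-1 * Lp_norm +oo%E f)
      x 1)
  /\
  (forall x : 'rV[R]_m.+1, half_space x ->
    sharp_gradient_constant (Lp +oo%E)
      (fun f z => height z ^+ (m.+1 - 2)%N * biharmonic_solution f z)
      (fun f => height x ^+ (m.+1 - 2)%N * Lp_norm +oo%E f)
      x (m.+1%:R - 1)).
Proof.
have pow (h b d : R) : 0 < h -> h `^ (b - d) * h `^ d = h `^ b.
  by move=> h0; rewrite -powRD ?subrK// (lt0r_neq0 h0) implybT.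
split=> [alpha p _ p1|].
  exists (sharp_constant m (m.+1%:R * alpha) p) => x hx; split.
    apply: sharp_biharmonic => // f z hz.
    exists (height z `^ (m.+1%:R * alpha - 2)) => //.
    by rewrite -(powR_mulrn 2 (ltW hz)) pow.
  apply: (sharp_gradient_constant_transfer (trace := snd)) => //.
  - by move=> vg [].
  - move=> f fL; exists (poisson_integral f, f) => //; split=> //.
    exact: harmonic_poisson (Lp_admissible p1 fL).
  - move=> vg z [fL _ vE] hz; rewrite vE// poisson_integralE//; last exact: Lp_admissible fL.
    by rewrite -(pow _ (m.+1%:R * alpha) 1 hz) powRr1 ?(ltW hz)//; ring.
split=> x hx.
  rewrite -(sharp_constant0 R m); apply: sharp_biharmonic => //.
  - exact: leey.
  - move=> f z hz; exists (height z ^- 2); first by rewrite mulrC.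
    by rewrite mulVf ?powRr0// expf_neq0// gt_eqF.
  - by move=> f; rewrite sub0r subr0 powR_invn// ltW.
rewrite -(sharp_constant_dim R m); apply: sharp_biharmonic => //.
- exact: leey.
- move=> f z hz; exists (height z ^+ (m.+1 - 2)) => //.
  by rewrite -exprD subnK ?powR_mulrn ?(ltW hz)// ltnW.
- move=> f; rewrite subr0 (_ : _ - 2 = (m.+1 - 2)%N%:R) ?powR_mulrn ?(ltW hx)//.
  by rewrite natrB// ltnW.
Qed.
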